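(* Let $M_0>0$ be a fixed constant. There exist constants $c_1,c_2>0$ depending only on $M_0$ such that the following holds. Let $n\ge 3$ be an integer and let $A$ be a nonempty set with $A\subset \mathsf{B}(n)\setminus \mathsf{B}(n\ln^{-M_0}n)$. Then, for all $s\in[0,1]$, $$\big|\mathbb{P}[\mathcal{V}(A)\le s]-s\big|\le c_1\Big(\frac{\ln\ln n}{\ln n}\Big)^{1/3}+c_2\,\ell^{(n)}_A\Big(\frac{\ln\ln n}{\ln n}\Big)^{-2/3},$$ and the same bound holds with $\mathcal{R}(A)$ in place of $\mathcal{V}(A)$, i.e. $$\big|\mathbb{P}[\mathcal{R}(A)\le s]-s\big|\le c_1\Big(\frac{\ln\ln n}{\ln n}\Big)^{1/3}+c_2\,\ell^{(n)}_A\Big(\frac{\ln\ln n}{\ln n}\Big)^{-2/3}.$$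
   Context: For $x,y\in\mathbb{Z}^2$ write $x\sim y$ if $x$ and $y$ are nearest neighbours in $\mathbb{Z}^2$. Let $(S_k)_{k\ge0}$ be the simple random walk on $\mathbb{Z}^2$ (transition probability $1/4$ to each neighbour). Its potential kernel is $$a(x)=\sum_{k=0}^\infty\big(\mathbb{P}_0[S_k=0]-\mathbb{P}_x[S_k=0]\big),\qquad x\in\mathbb{Z}^2,$$ where $\mathbb{P}_x$ is the law of the walk started at $x$; the series converges, $a(0)=0$, $a(x)>0$ for $x\ne0$, $a(x)=1$ for $x\sim 0$, and $\frac14\sum_{y\sim x}a(y)=a(x)$ for all $x\neq 0$. The conditioned walk $(\widehat S_k)_{k\ge 0}$ is the Markov chain on $\mathbb{Z}^2\setminus\{0\}$ with transition probabilities $\widehat P_{xy}=\frac{a(y)}{4a(x)}$ if $x\sim y$ (and $x\ne 0$), and $\widehat P_{xy}=0$ otherwise. It is started at a fixed neighbour $x_0$ of the origin, and $\mathbb{P}$ denotes the corresponding probability. Its range is $\widehat S_{[0,\infty)}=\bigcup_{m\ge0}\{\widehat S_m\}$. For nonempty finite $A\subset\mathbb{Z}^2$ put $$\mathcal{R}(A)=\frac{|A\cap\widehat S_{[0,\infty)}|}{|A|},\qquad \mathcal{V}(A)=\frac{|A\setminus\widehat S_{[0,\infty)}|}{|A|}=1-\mathcal{R}(A).$$ With $\|\cdot\|$ the Euclidean norm, $\mathsf{B}(x,r)=\{y\in\mathbb{Z}^2:\|y-x\|\le r\}$ and $\mathsf{B}(r)=\mathsf{B}(0,r)$. Here $\ln^{p}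 n$ means $(\ln n)^{p}$. For the given $M_0>0$, $$\ell^{(n)}_A=|A|^{-1}\max_{y\in A}\Big|A\cap\mathsf{B}\Big(y,\frac{n}{\ln^{M_0}n}\Big)\Big|.$$ *)

(* Defs.v *)
From HB Require Import structures.
From mathcomp Require Import all_boot all_order all_algebra finmap.
From mathcomp Require Import all_classical all_reals all_analysis.

Set Implicit Arguments.
Unset Strict Implicit.
Unset Printing Implicit Defensive.

Import Order.TTheory GRing.Theory Num.Theory.
Import numFieldNormedType.Exports.

Local Open Scope classical_set_scope.
Local Open Scope ring_scope.

Notation Z2 := (int * int)%type.

Definition nbrs (x : Z2) : seq Z2 :=
  [:: (x.1 + 1, x.2); (x.1 - 1, x.2); (x.1, x.2 + 1); (x.1, x.2 - 1)].

Definition adj (x y : Z2) : bool := y \in nbrs x.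

Definition enorm (R : realType) (x : Z2) : R :=
  Num.sqrt (x.1%:~R ^+ 2 + x.2%:~R ^+ 2).

Definition eball (R : realType) (x : Z2) (r : R) : pred Z2 :=
  [pred y | enorm R (y - x) <= r].

(* P_x[S_k = y] for the simple random walk S: the k-step transition
   probability, obtained by conditioning on the first step. *)
Fixpoint srw_prob (R : realType) (k : nat) (x y : Z2) : R :=
  if k is k'.+1 then \sum_(z <- nbrs x) 4^-1 * srw_prob R k' z y
  else (x == y)%:R.

Definition potential_kernel (R : realType) (x : Z2) : R :=
  limn (series (fun k => srw_prob R k 0 0 - srw_prob R k x 0)).

Definition cond_trans (R : realType) (x y : Z2) : R :=
  if (x != 0) && adj x y
  then potential_kernel R y / (4 * potential_kernel R x) else 0.

Definition path_event (Omega T : Type) (S : nat -> Omega -> T)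
    (k : nat) (p : nat -> T) : set Omega :=
  [set w | forall i, (i <= k)%N -> S i w = p i].

(* Markov chain on the countable state space E started at x0.  The last clause
   is P[S_{k+1} = p_{k+1} | S_0 = p_0, ..., S_k = p_k] = Q(p_k, p_{k+1}),
   multiplied out so that it is also meaningful (and trivially true) when the
   conditioning event is null. *)
Definition markov_chain (R : realType) (d : measure_display)
    (Omega : measurableType d) (P : probability Omega R) (T : countType)
    (E : set T) (Q : T -> T -> R) (x0 : T) (S : nat -> Omega -> T) : Prop :=
  [/\ forall k z, measurable (S k @^-1` [set z]),
      forall k w, E (S k w),
      P (S 0%N @^-1` [set x0]) = 1%E
    & forall k (p : nat -> T),
        P (path_event S k.+1 p) =
        (P (path_event S k p) * (Q (p k) (p k.+1))%:E)%E].

Definition conditioned_walk (R : realType) (d : measure_display)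
    (Omega : measurableType d) (P : probability Omega R) (x0 : Z2)
    (S : nat -> Omega -> Z2) : Prop :=
  markov_chain P [set x : Z2 | x != 0] (@cond_trans R) x0 S.

Definition walk_range (Omega : Type) (S : nat -> Omega -> Z2) (w : Omega) :
    set Z2 :=
  [set y | exists m, S m w = y].

Definition visited_frac (R : realType) (Omega : Type)
    (S : nat -> Omega -> Z2) (A : {fset Z2}) (w : Omega) : R :=
  #|` [fset y in A | y \in walk_range S w]%fset|%:R / #|` A|%:R.

Definition vacant_frac (R : realType) (Omega : Type)
    (S : nat -> Omega -> Z2) (A : {fset Z2}) (w : Omega) : R :=
  #|` [fset y in A | y \notin walk_range S w]%fset|%:R / #|` A|%:R.

Definition inner_radius (R : realType) (M0 : R) (n : nat) : R :=
  n%:R / ln n%:R `^ M0.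

Definition max_local_frac (R : realType) (M0 : R) (n : nat) (A : {fset Z2}) :
    R :=
  (#|` A|%:R)^-1 *
  (\max_(y <- enum_fset A)
     #|` [fset z in A | z \in eball y (inner_radius M0 n)]%fset|)%N%:R.

Definition error_bound (R : realType) (M0 c1 c2 : R) (n : nat)
    (A : {fset Z2}) : R :=
  let q := ln (ln n%:R) / ln n%:R in
  c1 * q `^ (1 / 3) + c2 * max_local_frac M0 n A * q `^ (- (2 / 3)).

(* Main.v *)
Require Import Defs.
From HB Require Import structures.
From mathcomp Require Import all_boot all_order all_algebra finmap.
From mathcomp Require Import all_classical all_reals all_analysis.
From mathcomp Require Import zify ring lra.

Set Implicit Arguments.
Unset Strict Implicit.
Unset Printing Implicit Defensive.

Import Order.TTheory GRing.Theory Num.Theory.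
Import numFieldNormedType.Exports.

Local Open Scope classical_set_scope.
Local Open Scope ring_scope.

(** Let a be the potential kernel and, for y different from the origin, let
    h_y(x) = (a(x) + a(y) - a(x-y)) / (2 a(x)). This function of x is harmonic for the
    conditioned walk except at y, where it equals 1, and it tends to 0 along the walk; it is
    the probability that y is ever visited from x. Since a(x) is a multiple of ln |x| up to
    O(1), two sites x and y of the annulus at distance more than n / ln^M0 n satisfy
    a(y) - a(x-y) = O(ln ln n), while a(x) is of order ln n. So h_y(x) = 1/2 + O(q) with
    q = ln ln n / ln n: whenever the walk sits on A, all unvisited sites but a fraction ell
    have a chance close to 1/2 of being visited later.

    This alone forces the uniform law. Let K be the current number of unvisited sites of A
    and H the current sum of h_y(position) over these sites y. Between visits H is a
    martingale; at a visit K and H both drop by 1. For fixed j one looks for a function D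
    such that [K < j] - H D(K) is a martingale when H is exactly K/2 after each visit. This is
    a first order recursion for D ([slope_rec]), solved by D(k) = 0 for k < j and
    D(k) = - 2j / (k(k+1)) for k >= j. In reality H differs from K/2 by at most
    eta = O(|A| (q + ell)). As K never increases, the errors of all visits together are at
    most eta times the total variation of D, which is at most 4/(j+1), whatever the number
    of steps ([corrector_exp]). At time 0, H is close to |A|/2 and the martingale is close
    to j/(|A|+1); at infinity H tends to 0 and only the probability of [K < j] is left
    ([never_visited_law]). Hence that probability is j/|A| up to O((q + ell) |A|/j). For
    j >= q^(1/3) |A| this is the asserted error, and for smaller j monotonicity in j costs
    another q^(1/3) ([never_visited_cdf]).

    The estimates of a come from the rotation (x1 + x2, x1 - x2), which turns the planar walk
    into a pair of independent walks on the integers ([srw_probE]). At even sites a is then a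
    series in central binomial probabilities, for which explicit bounds give the
    logarithmic growth ([potential_log_diff], [potential_ln_lb]) and the gradient bound
    C/|x| ([potential_grad]). The latter controls H at time 0, when the walk is next to the
    origin. Odd sites are reduced to even ones by harmonicity ([potential_harmonic]). *)

(** * Central binomial probabilities *)

Section CentralBinomial.
Variable R : realType.

(** The probability that the simple random walk on the integers, started at 0, is
at 2i after 2k steps. *)
Definition binp (k i : nat) : R := 'C(k.*2, k + i)%:R / 4 ^+ k.

Lemma binp_ge0 k i : 0 <= binp k i.
Proof. by rewrite /binp divr_ge0 ?ler0n ?exprn_ge0. Qed.

Lemma binp_succ k i :
  binp k i.+1 * (k%:R + i%:R + 1) = binp k i * (k%:R - i%:R).
Proof.
rewrite /binp mulrAC [RHS]mulrAC; congr (_ / _).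
have [lik|lki] := leqP i k.
  have := mul_bin_left k.*2 (k + i).
  rewrite -addnn subnDl addnS => /(congr1 (fun m => m%:R : R)).
  rewrite !natrM natrB // -addn1 !natrD mulrC => ->; by rewrite mulrC.
by rewrite !bin_small ?mul0r // -addnn ?ltn_add2l // ltnW // ltn_add2l.
Qed.

Lemma binp_step k i :
  binp k i - binp k i.+1 = binp k i * ((2 * i%:R + 1) / (k%:R + i%:R + 1)).
Proof.
have h : k%:R + i%:R + 1 != 0 :> R by rewrite -!natrD -(natrD _ _ 1) pnatr_eq0 addn1.
apply: (mulIf h); rewrite mulrBl binp_succ; field; exact: h.
Qed.

Lemma binp_le k i j : (i <= j)%N -> binp k j <= binp k i.
Proof.
move=> /subnK <-; elim: (j - i)%N => [|l ih]; first by rewrite add0n.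
apply: le_trans ih; rewrite addSn -subr_ge0 binp_step.
by rewrite mulr_ge0 ?binp_ge0 ?divr_ge0 ?addr_ge0 ?mulr_ge0.
Qed.

Lemma binp_small k i : (k < i)%N -> binp k i = 0.
Proof. by move=> h; rewrite /binp bin_small ?mul0r // -addnn ltn_add2l. Qed.

Lemma binp0S k : binp k.+1 0 * (2 * k%:R + 2) = binp k 0 * (2 * k%:R + 1).
Proof.
rewrite /binp !addn0 exprS.
have h1 : (k.+1 * 'C(k.+1.*2, k.+1) = k.+1.*2 * 'C(k.*2.+1, k))%N.
  by rewrite doubleS -mul_bin_diag.
have h2 : (k.+1 * 'C(k.*2.+1, k.+1) = k.*2.+1 * 'C(k.*2, k))%N.
  by rewrite mul_bin_diag.
have h3 : 'C(k.*2.+1, k) = 'C(k.*2.+1, k.+1).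
  by rewrite -bin_sub; [congr ('C(_, _)); lia | lia].
have h : (k.+1 * 'C(k.+1.*2, k.+1) = 2 * (k.*2.+1 * 'C(k.*2, k)))%N.
  by rewrite h1 h3 -h2 doubleS; lia.
move: h; set c0 := 'C(_, _); set c0' := 'C(_, _) => h.
have {}h : (k%:R + 1) * c0%:R = 2 * ((2 * k%:R + 1) * c0'%:R) :> R.
  by rewrite -(natrM _ 2 k) !natr1 -!natrM h -(mul2n k).
have e4 : 4 ^+ k != 0 :> R by rewrite expf_neq0 // pnatr_eq0.
apply: (mulIf e4).
rewrite -!mulrA; move: h; set c := c0%:R; set c' := c0'%:R => h.
have -> : c * ((4 * 4 ^+ k)^-1 * ((2 * k%:R + 2) * 4 ^+ k))
   = ((k%:R + 1) * c) / 2 by field.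
have -> : c' * ((4 ^+ k)^-1 * ((2 * k%:R + 1) * 4 ^+ k)) = (2 * k%:R + 1) * c'.
  by field.
by rewrite h; field.
Qed.

Lemma binp1 : binp 1 0 = 1 / 2.
Proof. by rewrite /binp /= expr1 (_ : 'C(_,_) = 2%N) //; field. Qed.

(** The sequence k binp(k,0)^2 is increasing, so its value at k = 1 bounds it from
below. *)
Lemma binp0_lb k : (0 < k)%N -> 1 / 4 <= k%:R * binp k 0 ^+ 2.
Proof.
case: k => // k _; elim: k => [|k ih]; first by rewrite binp1; lra.
apply: le_trans ih _.
have k0 : 0 <= k%:R :> R by [].
have e1 : k.+1%:R = k%:R + 1 :> R by rewrite natr1.
have e2 : k.+2%:R = k%:R + 2 :> R by rewrite -(natrD _ k 2) addn2.
have h := binp0S k.+1; rewrite e2 e1; rewrite e1 in h.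
set b := binp k.+1 0 in h *; set b' := binp _ 0 in h *.
have -> : b' = b * (2 * (k%:R + 1) + 1) / (2 * (k%:R + 1) + 2).
  by rewrite -h; field; lra.
have p : 0 < 2 * (k%:R + 1) + 2 :> R by lra.
rewrite -subr_ge0.
rewrite [X in 0 <= X](_ : _ = b ^+ 2 * ((2 * (k%:R + 1) + 2))^-1 ^+ 2 * (k%:R + 2)).
  by rewrite !mulr_ge0 ?sqr_ge0 //; lra.
by field; lra.
Qed.

(** Companion of the previous bound: (k + 1/2) binp(k,0)^2 is decreasing, with
value 3/8 at k = 1. *)
Lemma binp0_ub k : (0 < k)%N -> binp k 0 ^+ 2 <= (2 * k%:R)^-1.
Proof.
move=> k0; have : (k%:R + 1/2) * binp k 0 ^+ 2 <= 3/8.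
  case: k k0 => // k _; elim: k => [|k ih]; first by rewrite binp1; lra.
  apply: le_trans ih.
  have k0 : 0 <= k%:R :> R by [].
  have e1 : k.+1%:R = k%:R + 1 :> R by rewrite natr1.
have e2 : k.+2%:R = k%:R + 2 :> R by rewrite -(natrD _ k 2) addn2.
have h := binp0S k.+1; rewrite e2 e1; rewrite e1 in h.
  set b := binp k.+1 0 in h *; set b' := binp _ 0 in h *.
  have -> : b' = b * (2 * (k%:R + 1) + 1) / (2 * (k%:R + 1) + 2).
    by rewrite -h; field; lra.
  rewrite -subr_ge0.
  rewrite [X in 0 <= X](_ : _ = b ^+ 2 * ((2 * (k%:R + 1) + 2))^-1 ^+ 2 * (k%:R + 3/2)).
    by rewrite !mulr_ge0 ?sqr_ge0 //; lra.
  by field; lra.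
have kp : 0 < k%:R :> R by rewrite ltr0n.
move=> h; rewrite -[leRHS]mul1r ler_pdivlMr; last by lra.
have := sqr_ge0 (binp k 0); nra.
Qed.

(** Telescoping [binp_step]: the i-th relative decrement is at most (2i+1)/k, and
the odd numbers sum to a square. *)
Lemma binp_lb k i : (0 < k)%N ->
  binp k 0 * (1 - i%:R ^+ 2 / k%:R) <= binp k i.
Proof.
move=> k0; have kp : 0 < k%:R :> R by rewrite ltr0n.
elim: i => [|i ih]; first by rewrite expr0n mul0r subr0 mulr1.
have -> : binp k i.+1 = binp k i - (binp k i - binp k i.+1) by ring.
rewrite binp_step.
have i0 : 0 <= i%:R :> R by [].
have h : binp k i * ((2 * i%:R + 1) / (k%:R + i%:R + 1)) <=
   binp k 0 * ((2 * i%:R + 1) / k%:R).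
  apply: ler_pM; rewrite ?binp_ge0 ?binp_le //.
  by rewrite ler_pM2l ?lef_pV2 ?posrE; lra.
apply: le_trans (lerB ih h).
rewrite -natr1 le_eqVlt; apply/orP; left; apply/eqP; field; lra.
Qed.

(** For i < k the ratio 1 - (2i+1)/(k+i+1) of consecutive values is at most
exp(-(2i+1)/(2k)); the exponents again sum to a square. *)
Lemma binp_ub k i : (0 < k)%N ->
  binp k i <= binp k 0 * expR (- (i%:R ^+ 2 / (2 * k%:R))).
Proof.
move=> k0; have kp : 0 < k%:R :> R by rewrite ltr0n.
elim: i => [|i ih]; first by rewrite expr0n mul0r oppr0 expR0 mulr1.
have [lik|lki] := leqP i.+1 k; last first.
  by rewrite binp_small // mulr_ge0 ?binp_ge0 ?expR_ge0.
have -> : binp k i.+1 = binp k i - (binp k i - binp k i.+1) by ring.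
rewrite binp_step.
have i0 : 0 <= i%:R :> R by [].
have lik' : i%:R + 1 <= k%:R :> R by rewrite natr1 ler_nat.
have -> : - (i.+1%:R ^+ 2 / (2 * k%:R)) =
  - (i%:R ^+ 2 / (2 * k%:R)) + - ((2 * i%:R + 1) / (2 * k%:R)) :> R.
  by rewrite -natr1; field; lra.
rewrite expRD mulrA -{1}[binp k i]mulr1 -mulrBr.
apply: ler_pM ih _; rewrite ?binp_ge0 //.
  rewrite subr_ge0 ler_pdivrMr; lra.
apply: le_trans (expR_ge1Dx _); rewrite lerD2l lerN2.
rewrite ler_pM2l ?lef_pV2 ?posrE; lra.
Qed.

(** Since u^2 exp(-u) <= 4, the Gaussian factor is traded for a power of i, which
keeps the later sums over k polynomial. *)
Lemma binp_ub4 k i : (0 < k)%N ->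
  binp k i * i%:R ^+ 4 <= binp k 0 * (16 * k%:R ^+ 2).
Proof.
move=> k0; have kp : 0 < k%:R :> R by rewrite ltr0n.
set u : R := i%:R ^+ 2 / (2 * k%:R).
have u0 : 0 <= u by rewrite divr_ge0 ?sqr_ge0 //; lra.
have eu : expR (- u) * u ^+ 2 <= 4.
  have h : (1 + u / 2) ^+ 2 <= expR u.
    rewrite -[u in expR u](_ : u / 2 + u / 2 = u); last by field.
    rewrite expRD -expr2 lerXn2r ?nnegrE ?expR_ge0 ?expR_ge1Dx //; lra.
  rewrite expRN mulrC ler_pdivrMr ?expR_gt0 //; nra.
have ei : i%:R ^+ 4 = u ^+ 2 * (4 * k%:R ^+ 2) by rewrite /u; field; lra.
apply: le_trans (ler_wpM2r _ (binp_ub i k0)) _; first by rewrite exprn_ge0.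
rewrite -mulrA ler_wpM2l ?binp_ge0 // ei mulrA.
have := sqr_ge0 (k%:R : R); nra.
Qed.

End CentralBinomial.

(** * Sums of products of binomial probabilities *)

Section GreenSums.
Variable R : realType.
Local Notation binp := (@binp R).

(** The expected number of returns to the origin of the planar walk during its first
2K steps; this is where the logarithm in the potential kernel comes from. *)
Definition diag_sum (K : nat) : R := \sum_(1 <= k < K.+1) binp k 0 ^+ 2.

(** In the coordinates x1 + x2 = 2i and x1 - x2 = 2j the planar walk splits into two
independent walks on the integers, so this is the term of time 2k in the series of
the potential kernel at x. *)
Definition green_term (i j k : nat) : R := binp k 0 ^+ 2 - binp k i * binp k j.

Lemma green_term0 (i j : nat) : (0 < maxn i j)%N -> green_term i j 0 = 1.
Proof.
move=> M0; have b00 : binp 0 0 = 1 by rewrite /binp //= expr0 divr1.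
rewrite /green_term b00 expr1n.
have [i0|i0] := posnP i; last by rewrite (@binp_small _ _ i) ?mul0r ?subr0.
have [j0|j0] := posnP j; last by rewrite (@binp_small _ _ j) ?mulr0 ?subr0.
by move: M0; rewrite i0 j0.
Qed.

Lemma binp_prod_ub (i j k : nat) : (0 < k)%N ->
  binp k i * binp k j * (maxn i j)%:R ^+ 4 <= 8 * k%:R.
Proof.
move=> k0; have kp : 0 < k%:R :> R by rewrite ltr0n.
wlog ij : i j / (i <= j)%N.
  move=> h; have [ij|ji] := orP (leq_total i j); first by apply: h.
  rewrite [binp k i * _]mulrC maxnC. by apply: h.
rewrite (maxn_idPr ij) -mulrA.
apply: le_trans (ler_pM _ _ (binp_le R k (leq0n i)) (binp_ub4 R j k0)) _.
- exact: binp_ge0.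
- by rewrite mulr_ge0 ?binp_ge0 ?exprn_ge0.
rewrite [leLHS]mulrA -expr2.
apply: le_trans (ler_wpM2r _ (binp0_ub R k0)) _; first by rewrite mulr_ge0 ?exprn_ge0.
by rewrite le_eqVlt; apply/orP; left; apply/eqP; field; lra.
Qed.

Lemma green_term_ge0 (i j k : nat) : 0 <= green_term i j k.
Proof. by rewrite subr_ge0 expr2 ler_pM ?binp_ge0 ?binp_le. Qed.

Lemma green_term_ub (i j k : nat) : (0 < k)%N ->
  green_term i j k <= (maxn i j)%:R ^+ 2 / k%:R ^+ 2.
Proof.
move=> k0; have kp : 0 < k%:R :> R by rewrite ltr0n.
set M : R := (maxn i j)%:R.
have iM : i%:R ^+ 2 <= M ^+ 2 by rewrite lerXn2r ?nnegrE // ler_nat leq_maxl.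
have jM : j%:R ^+ 2 <= M ^+ 2 by rewrite lerXn2r ?nnegrE // ler_nat leq_maxr.
have b0 := binp_ge0 R k 0.
have hi := binp_lb R i k0; have hj := binp_lb R j k0.
have bi := binp_le R k (leq0n i); have bi0 := binp_ge0 R k i.
have bj0 := binp_ge0 R k j.
have h : green_term i j k <= binp k 0 ^+ 2 * (2 * M ^+ 2 / k%:R).
  have v0 : 0 <= k%:R^-1 :> R by rewrite invr_ge0 ltW.
  rewrite /green_term; set v := k%:R^-1 in hi hj v0 *.
  have h1 : binp k 0 * (binp k 0 * (1 - i%:R ^+ 2 * v)) <= binp k 0 * binp k i.
    exact: ler_wpM2l.
  have h2 : binp k i * (binp k 0 * (1 - j%:R ^+ 2 * v)) <= binp k i * binp k j.
    exact: ler_wpM2l.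
  have h3 : binp k i * (binp k 0 * (j%:R ^+ 2 * v)) <=
            binp k 0 * (binp k 0 * (j%:R ^+ 2 * v)).
    by rewrite ler_wpM2r // !mulr_ge0 // sqr_ge0.
  have h4 : binp k 0 ^+ 2 * v * i%:R ^+ 2 <= binp k 0 ^+ 2 * v * M ^+ 2.
    by rewrite ler_wpM2l // mulr_ge0 ?sqr_ge0.
  have h5 : binp k 0 ^+ 2 * v * j%:R ^+ 2 <= binp k 0 ^+ 2 * v * M ^+ 2.
    by rewrite ler_wpM2l // mulr_ge0 ?sqr_ge0.
  by lra.
apply: (le_trans h).
have M0 : 0 <= 2 * M ^+ 2 / k%:R by rewrite !mulr_ge0 ?sqr_ge0 // invr_ge0 ltW.
apply: le_trans (ler_wpM2r M0 (binp0_ub R k0)) _.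
by rewrite le_eqVlt; apply/orP; left; apply/eqP; field; lra.
Qed.

Lemma sum_inv_sqr_le (K n : nat) : (0 < K)%N -> (K <= n)%N ->
  \sum_(K.+1 <= k < n.+1) (k%:R ^+ 2)^-1 <= K%:R^-1 :> R.
Proof.
move=> K0 Kn.
suff: \sum_(K.+1 <= k < n.+1) (k%:R ^+ 2)^-1 <= K%:R^-1 - n%:R^-1 :> R.
  by move/le_trans; apply; rewrite gerBl invr_ge0.
move/subnK : Kn => <-; elim: (n - K)%N => [|m ih].
  by rewrite big_geq // subrr.
rewrite addSn big_nat_recr ?ltnS ?leq_addl //=.
apply: le_trans (lerD ih (lexx _)) _.
have p : 0 < (m + K)%:R :> R by rewrite ltr0n addn_gt0 K0 orbT.
rewrite -natr1; set x : R := (m + K)%:R in p *.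
rewrite -addrA lerD2l -subr_ge0.
rewrite [X in 0 <= X](_ : _ = x^-1 * ((x + 1) ^-1) ^+ 2); last by field; lra.
by rewrite mulr_ge0 ?sqr_ge0 // invr_ge0 ltW.
Qed.

(** Put M = max(i,j). Up to time M^2 the walk has not noticed the distance M, and the
products [binp k i * binp k j] contribute O(1) in total; after that time the two
terms of the difference nearly cancel, leaving O(M^2/k^2). *)
Lemma green_sum_diag (i j n : nat) : (0 < maxn i j)%N -> (maxn i j ^ 2 <= n)%N ->
  `|\sum_(0 <= k < n.+1) green_term i j k - diag_sum (maxn i j ^ 2)| <= 8.
Proof.
set M := maxn i j => M0; set K := (M ^ 2)%N => Kn.
have K0 : (0 < K)%N by rewrite expn_gt0 M0.
have Mp : 0 < M%:R :> R by rewrite ltr0n.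
rewrite big_nat_recl // (big_cat_nat _ (n := K)) //=.
have e0 := green_term0 M0.
have -> : \sum_(0 <= k < K) green_term i j k.+1 = diag_sum K -
    \sum_(1 <= k < K.+1) binp k i * binp k j.
  by rewrite /diag_sum -sumrB big_add1.
have h1 : 0 <= \sum_(1 <= k < K.+1) binp k i * binp k j.
  by apply: sumr_ge0 => k _; rewrite mulr_ge0 ?binp_ge0.
have h2 : \sum_(1 <= k < K.+1) binp k i * binp k j <= 8.
  apply: (@le_trans _ _ (\sum_(1 <= k < K.+1) 8 / K%:R)).
    rewrite !big_nat; apply: ler_sum => k /andP[k1 kK].
    have := binp_prod_ub i j k1; rewrite -/M.
    rewrite -ler_pdivlMr ?exprn_gt0 // => /le_trans; apply.
    rewrite ler_pdivrMr ?exprn_gt0 //.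
    rewrite /K natrX [leRHS](_ : _ = 8 * (M ^ 2)%:R); last first.
      by rewrite natrX; field; lra.
    by rewrite ler_pM2l // ler_nat.
  rewrite sumr_const_nat subn1 /= -[X in X <= _]mulr_natr divfK // pnatr_eq0; lia.
have h3 : 0 <= \sum_(K <= k < n) green_term i j k.+1.
  by apply: sumr_ge0 => k _; apply: green_term_ge0.
have h4 : \sum_(K <= k < n) green_term i j k.+1 <= 1.
  apply: (@le_trans _ _ (\sum_(K.+1 <= k < n.+1) M%:R ^+ 2 * (k%:R ^+ 2)^-1)).
    rewrite big_add1 /= !big_nat; apply: ler_sum => k _.
    exact: green_term_ub.
  rewrite -mulr_sumr; have := sum_inv_sqr_le K0 Kn.
  move/(ler_wpM2l (sqr_ge0 M%:R))/le_trans; apply.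
  by rewrite /K natrX divff // expf_neq0 // gt_eqF.
rewrite ler_norml e0; lra.
Qed.

Lemma diag_sum_lb (K : nat) : ln K.+1%:R / 4 <= diag_sum K.
Proof.
elim: K => [|K ih]; first by rewrite ln1 mul0r /diag_sum big_geq.
rewrite /diag_sum big_nat_recr //=.
have kp : 0 < K.+1%:R :> R by rewrite ltr0n.
have h : ln K.+2%:R <= ln K.+1%:R + K.+1%:R^-1 :> R.
  have e : K.+2%:R = K.+1%:R * (1 + K.+1%:R^-1) :> R.
    by rewrite mulrDr mulr1 divff ?natr1 // gt_eqF.
  have v0 : 0 < K.+1%:R^-1 :> R by rewrite invr_gt0.
  rewrite e lnM ?posrE // lerD2l le_ln1Dx //.
  by apply: lt_trans v0; lra.
have h2 : K.+1%:R^-1 / 4 <= binp K.+1 0 ^+ 2.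
  rewrite -(ler_pM2l kp) mulrA divff ?gt_eqF //.
  exact: binp0_lb.
by apply: le_trans (lerD ih h2); rewrite -mulrDl ler_pM2r.
Qed.

Lemma diag_sum_ub (K K' : nat) : (0 < K)%N -> (K <= K')%N ->
  0 <= diag_sum K' - diag_sum K <= (ln K'%:R - ln K%:R) / 2.
Proof.
move=> K0 /subnK <-; elim: (K' - K)%N => [|m /andP[ih1 ih2]].
  by rewrite !add0n !subrr mul0r lexx.
rewrite addSn /diag_sum big_nat_recr //= -/(diag_sum _) -/(diag_sum _).
set n := (m + K)%N in ih1 ih2 *.
have n0 : (0 < n)%N by rewrite /n; lia.
have np : 0 < n%:R :> R by rewrite ltr0n.
have h : n.+1%:R^-1 <= ln n.+1%:R - ln n%:R :> R.
  have e : n%:R = n.+1%:R * (1 - n.+1%:R^-1) :> R.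
    by rewrite mulrBr mulr1 divff ?gt_eqF // -natr1 addrK.
  have v1 : n.+1%:R^-1 < 1 :> R by rewrite invf_lt1 ?ltr0n // ltr1n.
  have : ln (1 - n.+1%:R^-1) <= - n.+1%:R^-1 :> R by apply: le_ln1Dx; rewrite ltrN2.
  rewrite e lnM ?posrE ?ltr0n ?subr_gt0 // => h; set v := n.+1%:R^-1 in h *; lra.
have := binp0_ub R (ltn0Sn n); rewrite invfM => h2.
have := sqr_ge0 (binp n.+1 0) => h3.
by move: h h2; set v := n.+1%:R^-1 => h h2; apply/andP; split; lra.
Qed.

(** The difference contributes an extra factor O(M/k). The fourth power in
[binp_prod_ub] makes the terms O(M^-3) up to time M^2; with a square only, a
factor ln M would remain. *)
Lemma green_grad_sum (i j n : nat) : (0 < maxn i j)%N ->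
  \sum_(0 <= k < n) binp k j * (binp k i - binp k i.+1) <= 40 / (maxn i j)%:R.
Proof.
set M := maxn i j => M0.
have Mp : 0 < M%:R :> R by rewrite ltr0n.
have M1 : 1 <= M%:R :> R by rewrite ler1n.
have iM : i%:R <= M%:R :> R by rewrite ler_nat leq_maxl.
set K := (M ^ 2)%N.
have K0 : (0 < K)%N by rewrite expn_gt0 M0.
have t0 k : 0 <= binp k j * (binp k i - binp k i.+1).
  by rewrite mulr_ge0 ?binp_ge0 // subr_ge0 binp_le.
have step k : (0 < k)%N -> binp k j * (binp k i - binp k i.+1) <=
    binp k i * binp k j * (3 * M%:R / k%:R).
  move=> k0; have kp : 0 < k%:R :> R by rewrite ltr0n.
  rewrite binp_step mulrA [binp k j * _]mulrC ler_wpM2l ?mulr_ge0 ?binp_ge0 //.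
  have i0 : 0 <= i%:R :> R by [].
  apply: ler_pM; rewrite ?invr_ge0 ?lef_pV2 ?posrE; lra.
(* The terms are nonnegative, so the range may be enlarged beyond K. *)
apply: (@le_trans _ _ (\sum_(0 <= k < (K + n).+1) binp k j * (binp k i - binp k i.+1))).
  rewrite [leRHS](big_cat_nat _ (n := n)) //=; last by lia.
  by rewrite lerDl sumr_ge0.
rewrite big_nat_recl // (big_cat_nat _ (n := K)) //=; last by lia.
have -> : binp 0 j * (binp 0 i - binp 0 i.+1) = 0.
  rewrite (@binp_small _ 0 i.+1) // subr0.
  have [i0|i0] := posnP i; last by rewrite (@binp_small _ 0 i) // mulr0.
  have [j0|j0] := posnP j; last by rewrite (@binp_small _ 0 j) // mul0r.
  by move: M0; rewrite /M i0 j0.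
rewrite add0r.
have h1 : \sum_(0 <= k < K) binp k.+1 j * (binp k.+1 i - binp k.+1 i.+1)
   <= 24 / M%:R.
  apply: (@le_trans _ _ (\sum_(0 <= k < K) 24 / M%:R ^+ 3)).
    apply: ler_sum => k _; apply: le_trans (step _ _) _ => //.
    have kp : 0 < k.+1%:R :> R by rewrite ltr0n.
    have := binp_prod_ub i j (ltn0Sn k); rewrite -/M.
    rewrite -ler_pdivlMr ?exprn_gt0 // => h.
    apply: le_trans (ler_wpM2r _ h) _.
      by rewrite !mulr_ge0 // invr_ge0 ltW.
    by rewrite le_eqVlt; apply/orP; left; apply/eqP; field; lra.
  rewrite sumr_const_nat subn0 -[X in X <= _]mulr_natr /K natrX.
  by rewrite le_eqVlt; apply/orP; left; apply/eqP; field; lra.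
have h2 : \sum_(K <= k < K + n) binp k.+1 j * (binp k.+1 i - binp k.+1 i.+1)
   <= 16 / M%:R.
  apply: (@le_trans _ _ (\sum_(K.+1 <= k < (K + n).+1) 3 * M%:R * (k%:R ^+ 2)^-1)).
    rewrite big_add1 /= !big_nat; apply: ler_sum => k _.
    apply: le_trans (step _ _) _ => //.
    have kp : 0 < k.+1%:R :> R by rewrite ltr0n.
    have h : binp k.+1 i * binp k.+1 j <= k.+1%:R^-1.
      apply: (@le_trans _ _ (binp k.+1 0 ^+ 2)).
        by rewrite expr2 ler_pM ?binp_ge0 ?binp_le.
      apply: le_trans (binp0_ub R (ltn0Sn k)) _.
      rewrite lef_pV2 ?posrE; lra.
    apply: le_trans (ler_wpM2r _ h) _.
      by rewrite !mulr_ge0 // invr_ge0 ltW.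
    by rewrite le_eqVlt; apply/orP; left; apply/eqP; field; lra.
  rewrite -mulr_sumr; have := sum_inv_sqr_le K0 (leq_addr n K).
  have p3 : 0 <= 3 * M%:R :> R by lra.
  move/(ler_wpM2l p3)/le_trans; apply.
  rewrite /K natrX [leLHS](_ : _ = 3 / M%:R); last by field; lra.
  by rewrite ler_pM2r ?invr_gt0 //; lra.
apply: le_trans (lerD h1 h2) _; rewrite -mulrDl ler_pM2r ?invr_gt0 //; lra.
Qed.

End GreenSums.

(** * Return probabilities of the planar walk *)

Section ReturnProbabilities.
Variable R : realType.
Local Notation binp := (@binp R).
Local Notation srw := (@srw_prob R).

Fixpoint walk1 (k : nat) (u : int) : R :=
  if k is k'.+1 then (walk1 k' (u + 1) + walk1 k' (u - 1)) / 2
  else (u == 0)%:R.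

Lemma sum_nbrs (V : nmodType) (f : Z2 -> V) (x : Z2) : \sum_(z <- nbrs x) f z =
  f (x.1 + 1, x.2) + f (x.1 - 1, x.2) + f (x.1, x.2 + 1) + f (x.1, x.2 - 1).
Proof. by rewrite /nbrs !big_cons big_nil addr0 !addrA. Qed.

(** In the coordinates x1 + x2 and x1 - x2 the four steps of the planar walk are the
four choices of two signs. *)
Lemma srw_probE k x : srw k x 0 = walk1 k (x.1 + x.2) * walk1 k (x.1 - x.2).
Proof.
elim: k x => [|k ih] [x1 x2] /=.
  rewrite -natrM mulnb; congr (_%:R); congr nat_of_bool.
  rewrite xpair_eqE; apply/idP/idP; lia.
rewrite -/nbrs sum_nbrs /= !ih /=.
have -> : x1 + 1 + x2 = x1 + x2 + 1 by ring.
have -> : x1 + 1 - x2 = x1 - x2 + 1 by ring.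
have -> : x1 - 1 + x2 = x1 + x2 - 1 by ring.
have -> : x1 - 1 - x2 = x1 - x2 - 1 by ring.
have -> : x1 + (x2 + 1) = x1 + x2 + 1 by ring.
have -> : x1 - (x2 + 1) = x1 - x2 - 1 by ring.
have -> : x1 + (x2 - 1) = x1 + x2 - 1 by ring.
have -> : x1 - (x2 - 1) = x1 - x2 + 1 by ring.
by field.
Qed.

Lemma walk1N k u : walk1 k (- u) = walk1 k u.
Proof.
elim: k u => [|k ih] u /=; first by rewrite oppr_eq0.
have -> : - u + 1 = - (u - 1) by ring.
have -> : - u - 1 = - (u + 1) by ring.
by rewrite !ih addrC.
Qed.

Lemma walk1_far k u : u < - k%:Z -> walk1 k u = 0.
Proof.
elim: k u => [|k ih] u hu /=; first by case: eqP => // ?; lia.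
by rewrite !ih ?addr0 ?mul0r //; lia.
Qed.

Lemma walk1_bin k (j : nat) : walk1 k ((j + j)%N%:Z - k%:Z) = 'C(k, j)%:R / 2 ^+ k.
Proof.
elim: k j => [|k ih] j /=.
  rewrite bin0n expr0 divr1 subr0; congr (_%:R); congr nat_of_bool.
  by apply/idP/idP; lia.
have -> : (j + j)%N%:Z - k.+1%:Z + 1 = (j + j)%N%:Z - k%:Z by lia.
rewrite ih exprS; case: j => [|j].
  rewrite walk1_far; last by lia.
  by rewrite !bin0 addr0; field; rewrite expf_neq0.
have -> : (j.+1 + j.+1)%N%:Z - k.+1%:Z - 1 = (j + j)%N%:Z - k%:Z by lia.
by rewrite ih binS natrD; field; rewrite expf_neq0.
Qed.

Lemma walk1_even k (i : int) : walk1 k.*2 (i + i) = binp k `|i|%N.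
Proof.
suff h (l : nat) : walk1 k.*2 (l%:Z + l%:Z) = binp k l.
  case: (intP i) => [|l|l]; rewrite ?h //.
  by rewrite -opprD walk1N h abszN.
have -> : l%:Z + l%:Z = ((k + l) + (k + l))%N%:Z - (k.*2)%:Z by lia.
by rewrite walk1_bin /binp -mul2n exprM (_ : 2 ^+ 2 = 4 :> R) //; ring.
Qed.

Lemma walk1_odd k u : odd `|u|%N != odd k -> walk1 k u = 0.
Proof.
elim: k u => [|k ih] u /=; first by case: (u =P 0) => [->|].
move=> h; rewrite !ih ?addr0 ?mul0r //; lia.
Qed.

End ReturnProbabilities.

(** * The potential kernel *)

Section PotentialKernel.
Variable R : realType.
Local Notation binp := (@binp R).
Local Notation srw := (@srw_prob R).
Local Notation a := (@potential_kernel R).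

Definition green_sum (i j n : nat) : R := \sum_(0 <= k < n) green_term R i j k.

(** The potential kernel at an even site, in rotated coordinates. *)
Definition green (i j : nat) : R := limn (green_sum i j).

Lemma green_sum_nd i j : nondecreasing_seq (green_sum i j).
Proof.
move=> m n mn; rewrite /green_sum [leRHS](big_cat_nat _ (n := m)) //=.
by rewrite lerDl sumr_ge0 // => k _; apply: green_term_ge0.
Qed.

Lemma green_sum00 n : green_sum 0 0 n = 0.
Proof. by rewrite /green_sum big1 // => k _; rewrite /green_term -expr2 subrr. Qed.

Lemma is_cvg_green_sum i j : cvgn (green_sum i j).
Proof.
have [M0|M0] := posnP (maxn i j).
  have [-> ->] : i = 0%N /\ j = 0%N by lia.
  rewrite (_ : green_sum 0 0 = (fun=> 0)); first exact: is_cvg_cst.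
  by apply/funext => n; rewrite green_sum00.
apply: nondecreasing_is_cvgn; first exact: green_sum_nd.
exists (diag_sum R (maxn i j ^ 2) + 8) => _ [n _ <-].
apply: le_trans (green_sum_nd i j (_ : (n <= (n + maxn i j ^ 2).+1)%N)) _; first by lia.
have := @green_sum_diag R i j (n + maxn i j ^ 2) M0 (leq_addl _ _).
by rewrite -/(green_sum i j _) ler_norml => /andP[_]; rewrite lerBlDl.
Qed.

Lemma green00 : green 0 0 = 0.
Proof.
rewrite /green (_ : green_sum 0 0 = (fun=> 0)); first exact: lim_cst.
by apply/funext => n; rewrite green_sum00.
Qed.

Lemma greenC i j : green i j = green j i.
Proof.
rewrite /green; congr (limn _); apply/funext => n; apply: eq_bigr => k _.
by rewrite /green_term mulrC.
Qed.

Lemma green_ge1 i j : (0 < maxn i j)%N -> 1 <= green i j.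
Proof.
move=> M0; apply: le_trans (nondecreasing_cvgn_le (green_sum_nd i j)
  (@is_cvg_green_sum i j) 1).
by rewrite /green_sum big_nat1 green_term0.
Qed.

Lemma green_diag i j : (0 < maxn i j)%N ->
  `|green i j - diag_sum R (maxn i j ^ 2)| <= 8.
Proof.
move=> M0; have cg := @is_cvg_green_sum i j.
have h : \forall n \near \oo,
    diag_sum R (maxn i j ^ 2) - 8 <= green_sum i j n <= diag_sum R (maxn i j ^ 2) + 8.
  exists (maxn i j ^ 2).+1 => // -[//|n] /= Hn.
  have := @green_sum_diag R i j n M0 Hn.
  rewrite -/(green_sum i j _) ler_norml; lra.
have h1 : diag_sum R (maxn i j ^ 2) - 8 <= green i j.
  by apply: limr_ge cg _; apply: filterS h => n /andP[].
have h2 : green i j <= diag_sum R (maxn i j ^ 2) + 8.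
  by apply: limr_le cg _; apply: filterS h => n /andP[].
rewrite ler_norml; lra.
Qed.

Lemma green_incr i j : (0 < maxn i j)%N ->
  `|green i.+1 j - green i j| <= 40 / (maxn i j)%:R.
Proof.
move=> M0.
have c1 := @is_cvg_green_sum i.+1 j; have c2 := @is_cvg_green_sum i j.
have e n : green_sum i.+1 j n - green_sum i j n =
    \sum_(0 <= k < n) binp k j * (binp k i - binp k i.+1).
  rewrite /green_sum -sumrB; apply: eq_bigr => k _; rewrite /green_term; ring.
rewrite /green -limB // ger0_norm.
  by apply: limr_le (is_cvgB c1 c2) _; apply: nearW => n; rewrite /= !fctE e green_grad_sum.
apply: limr_ge (is_cvgB c1 c2) _; apply: nearW => n; rewrite /= !fctE e.
by apply: sumr_ge0 => k _; rewrite mulr_ge0 ?binp_ge0 // subr_ge0 binp_le.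
Qed.

Definition partial_kernel (x : Z2) : R^nat := series (fun k => srw k 0 0 - srw k x 0).

Lemma srw_return n : srw n 0 0 = walk1 R n 0 * walk1 R n 0.
Proof.
by rewrite srw_probE (_ : (0 : Z2).1 + (0 : Z2).2 = 0) // (_ : _ - _ = 0).
Qed.

Lemma partial_kernelS (x : Z2) n :
  partial_kernel x n.+1 = partial_kernel x n + (srw n 0 0 - srw n x 0).
Proof. by rewrite /partial_kernel !seriesEnat /= big_nat_recr. Qed.

(** The terms of odd time vanish at an even site, whence [uphalf]. *)
Lemma partial_kernel_even (x : Z2) (i j : int) n :
  x.1 + x.2 = i + i -> x.1 - x.2 = j + j ->
  partial_kernel x n = green_sum `|i| `|j| (uphalf n).
Proof.
move=> hi hj; elim: n => [|n ih].
  by rewrite /partial_kernel /green_sum seriesEnat /= !big_geq.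
rewrite partial_kernelS ih srw_return srw_probE hi hj.
have [on|en] := boolP (odd n).
  rewrite !(@walk1_odd _ n); [|by rewrite on; lia..].
  rewrite !mul0r subrr addr0; suff -> : uphalf n.+1 = uphalf n by [].
  by rewrite /= uphalf_half on.
have -> : uphalf n.+1 = (n./2).+1 by [].
have -> : uphalf n = n./2 by rewrite uphalf_half (negbTE en).
have -> : n = (n./2).*2 by rewrite -[LHS]odd_double_half (negbTE en).
have := @walk1_even R n./2 0; rewrite addr0 => ->.
rewrite !walk1_even absz0 doubleK /green_sum big_nat_recr //= addrC.
Qed.

Lemma uphalf_cvg : uphalf @ \oo --> \oo.
Proof.
apply/cvgnyPge => N; exists N.*2 => // n /= Hn.
by rewrite uphalf_half; lia.
Qed.

Lemma partial_kernel_cvg_even (x : Z2) (i j : int) :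
  x.1 + x.2 = i + i -> x.1 - x.2 = j + j ->
  partial_kernel x @ \oo --> green `|i| `|j|.
Proof.
move=> hi hj.
rewrite (_ : partial_kernel x = green_sum `|i| `|j| \o uphalf).
  exact: cvg_comp uphalf_cvg (@is_cvg_green_sum _ _).
by apply/funext => n; apply: partial_kernel_even.
Qed.

Lemma potential_even (x : Z2) (i j : int) :
  x.1 + x.2 = i + i -> x.1 - x.2 = j + j -> a x = green `|i| `|j|.
Proof. by move=> hi hj; apply/cvg_lim => //; apply: partial_kernel_cvg_even. Qed.

(** Decomposition at the first step. In the limit it yields both the convergence of
the series at odd sites, whose neighbours are even, and the harmonicity of its sum. *)
Lemma partial_kernel_rec (x : Z2) n :
  partial_kernel x n.+1 =
  srw n 0 0 - (x == 0)%:R + 4^-1 * \sum_(z <- nbrs x) partial_kernel z n.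
Proof.
elim: n => [|n ih].
  have e z : partial_kernel z 0 = 0 by rewrite /partial_kernel seriesEnat /= big_geq.
  by rewrite partial_kernelS sum_nbrs !e !addr0 mulr0 addr0 add0r.
rewrite partial_kernelS ih.
have e z : partial_kernel z n.+1 = srw n 0 0 - srw n z 0 + partial_kernel z n.
  by rewrite partial_kernelS addrC.
have -> : srw n.+1 x 0 = 4^-1 * \sum_(z <- nbrs x) srw n z 0.
  by rewrite mulr_sumr.
by rewrite !sum_nbrs !e; field.
Qed.

(** Parity and [binp0_ub] bound the return probability at time n + 1 by 1/(n + 1). *)
Lemma srw_return_cvg : srw n 0 0 @[n --> \oo] --> (0 : R).
Proof.
rewrite (_ : (fun n => srw n 0 0) = (fun n => walk1 R n 0 * walk1 R n 0)); last first.
  by apply/funext => n; rewrite srw_return.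
rewrite -cvg_shiftS.
apply: (@squeeze_cvgr _ _ _ _ (fun=> 0) (@harmonic R)); last 2 first.
- exact: cvg_cst.
- exact: cvg_harmonic.
apply: nearW => n; change (0 <= walk1 R n.+1 0 * walk1 R n.+1 0 <= harmonic n).
have [on|en] := boolP (odd n).
  have -> : n.+1 = (uphalf n).*2 by rewrite uphalf_half on; lia.
  have h0 : (0 < uphalf n)%N by rewrite uphalf_half on.
  have := @walk1_even R (uphalf n) 0; rewrite addr0 => ->.
  rewrite /harmonic /= -expr2 sqr_ge0 /=.
  apply: le_trans (binp0_ub R h0) _.
  have -> : n.+1 = (2 * uphalf n)%N by rewrite uphalf_half on; lia.
  by rewrite natrM.
rewrite walk1_odd /=; last by rewrite en.
by rewrite mul0r lexx /= /harmonic /= invr_ge0.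
Qed.

Lemma partial_kernel_rec_cvg (x : Z2) :
  (forall z, z \in nbrs x -> cvgn (partial_kernel z)) ->
  partial_kernel x @ \oo --> - (x == 0)%:R + 4^-1 * \sum_(z <- nbrs x) a z.
Proof.
move=> cz; rewrite -cvg_shiftS.
rewrite (_ : [sequence _]_n = (fun n => srw n 0 0 - (x == 0)%:R +
  4^-1 * \sum_(z <- nbrs x) partial_kernel z n)); last first.
  by apply/funext => n /=; rewrite partial_kernel_rec.
apply: cvgD.
  rewrite -[X in _ --> X]add0r; apply: cvgD; first exact: srw_return_cvg.
  exact: cvg_cst.
apply: cvgMr; rewrite sum_nbrs.
under eq_fun do rewrite sum_nbrs.
have h z : z \in nbrs x -> partial_kernel z @ \oo --> a z by move/cz.
by do !apply: cvgD; apply: h; rewrite /nbrs !inE eqxx ?orbT.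
Qed.

Lemma even_coords (x : Z2) : ~~ odd (absz (x.1 + x.2)) ->
  exists i j : int, x.1 + x.2 = i + i /\ x.1 - x.2 = j + j.
Proof.
move=> h; exists (divz (x.1 + x.2) 2), (divz (x.1 - x.2) 2); split; lia.
Qed.

Lemma nbrs_parity (x z : Z2) : z \in nbrs x ->
  odd (absz (z.1 + z.2)) = ~~ odd (absz (x.1 + x.2)).
Proof. by rewrite /nbrs !inE => /or4P[] /eqP -> /=; lia. Qed.

Lemma is_cvg_partial_kernel (x : Z2) : cvgn (partial_kernel x).
Proof.
have ev z : ~~ odd (absz (z.1 + z.2)) -> cvgn (partial_kernel z).
  move/even_coords => [i [j [hi hj]]]; apply/cvg_ex; eexists.
  exact: partial_kernel_cvg_even hi hj.
have [ox|ex] := boolP (odd (absz (x.1 + x.2))); last exact: ev.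
apply/cvg_ex; eexists; apply: partial_kernel_rec_cvg => z /nbrs_parity hz.
by apply: ev; rewrite hz ox.
Qed.

Lemma potential_harmonic (x : Z2) :
  4^-1 * \sum_(z <- nbrs x) a z = a x + (x == 0)%:R.
Proof.
have -> : a x = - (x == 0)%:R + 4^-1 * \sum_(z <- nbrs x) a z.
  apply/cvg_lim => //; apply: partial_kernel_rec_cvg => z _.
  exact: is_cvg_partial_kernel.
by ring.
Qed.

Lemma potentialN (x : Z2) : a (- x) = a x.
Proof.
rewrite /potential_kernel; congr (limn (series _)); apply/funext => k.
congr (_ - _); rewrite !srw_probE /= -opprD walk1N; congr (_ * _).
by rewrite -opprD walk1N.
Qed.

Lemma potential0 : a 0 = 0.
Proof. by rewrite (@potential_even _ 0 0) ?green00. Qed.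

End PotentialKernel.

(** * The Euclidean norm on the planar lattice *)

Section EuclideanNorm.
Variable R : realType.
Local Notation nrm := (enorm R).

Lemma enorm_ge0 x : 0 <= nrm x. Proof. exact: sqrtr_ge0. Qed.

Lemma enorm_sqr x : nrm x ^+ 2 = x.1%:~R ^+ 2 + x.2%:~R ^+ 2.
Proof. by rewrite sqr_sqrtr // addr_ge0 ?sqr_ge0. Qed.

Lemma enormN x : nrm (- x) = nrm x.
Proof. by rewrite /enorm /= !rmorphN /= !sqrrN. Qed.

Lemma enorm0 : nrm 0 = 0.
Proof. by rewrite /enorm /= expr0n addr0 sqrtr0. Qed.

Lemma enorm_ge1 x : x != 0 -> 1 <= nrm x.
Proof.
move=> x0; rewrite -[leLHS]sqrtr1 ler_sqrt ?addr_ge0 ?sqr_ge0 //.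
rewrite -!rmorphXn -rmorphD /= ler1z.
by move: x0; case: x => u v; rewrite /= xpair_eqE negb_and => /orP[]; nia.
Qed.

Lemma enorm_triangle x y : nrm (x + y) <= nrm x + nrm y.
Proof.
have nx := enorm_ge0 x; have ny := enorm_ge0 y.
rewrite -(@ler_pXn2r _ 2) ?nnegrE ?addr_ge0 ?enorm_ge0 //.
rewrite sqrrD !enorm_sqr /= !rmorphD /=.
set u1 := x.1%:~R; set u2 := x.2%:~R; set v1 := y.1%:~R; set v2 := y.2%:~R.
suff : u1 * v1 + u2 * v2 <= nrm x * nrm y by rewrite mulr2n; lra.
apply: (le_trans (ler_norm _)).
rewrite -(@ler_pXn2r _ 2) ?nnegrE ?mulr_ge0 //.
rewrite real_normK ?num_real // exprMn !enorm_sqr -/u1 -/u2 -/v1 -/v2.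
have := sqr_ge0 (u1 * v2 - u2 * v1); nra.
Qed.

Lemma enorm_nbr x z : z \in nbrs x -> nrm x <= nrm z + 1 /\ nrm z <= nrm x + 1.
Proof.
move=> hz; have e1 : nrm (x - z) = 1.
  rewrite /enorm -[RHS]sqrtr1; congr Num.sqrt; rewrite -!rmorphXn -rmorphD -[1]/(1%:~R).
  by move: hz; rewrite /nbrs !inE => /or4P[] /eqP -> /=; congr (_%:~R); ring.
have e2 : nrm (z - x) = 1 by rewrite -enormN opprB.
split; first by rewrite -[in leLHS](subrK z x) addrC -e1 enorm_triangle // addrC.
by rewrite -[in leLHS](subrK x z) addrC -e2 enorm_triangle // addrC.
Qed.

(** If i and j are the rotated coordinates then |x|^2 = 2 (i^2 + j^2). *)
Lemma enorm_even x (i j : int) : x.1 + x.2 = i + i -> x.1 - x.2 = j + j ->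
  (maxn `|i| `|j|)%:R <= nrm x <= 2 * (maxn `|i| `|j|)%:R.
Proof.
move=> hi hj.
have e : nrm x ^+ 2 = 2 * (`|i|%N%:R ^+ 2 + `|j|%N%:R ^+ 2).
  have sq (l : int) : `|l|%N%:R ^+ 2 = l%:~R ^+ 2 :> R.
    by rewrite natr_absz intr_norm real_normK ?num_real.
  rewrite enorm_sqr !sq.
  have -> : x.1 = i + j by lia.
  have -> : x.2 = i - j by lia.
  by rewrite rmorphB rmorphD /=; ring.
set M := maxn _ _.
have iM : `|i|%N%:R ^+ 2 <= M%:R ^+ 2 :> R by rewrite lerXn2r ?nnegrE // ler_nat leq_maxl.
have jM : `|j|%N%:R ^+ 2 <= M%:R ^+ 2 :> R by rewrite lerXn2r ?nnegrE // ler_nat leq_maxr.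
have Mij : M%:R ^+ 2 <= `|i|%N%:R ^+ 2 + `|j|%N%:R ^+ 2 :> R.
  by rewrite /M /maxn; case: ifP => _; rewrite ?lerDl ?lerDr sqr_ge0.
have s1 := sqr_ge0 (`|i|%N%:R : R); have s2 := sqr_ge0 (`|j|%N%:R : R).
apply/andP; split.
  rewrite -(@ler_pXn2r _ 2) ?nnegrE ?enorm_ge0 // e; lra.
rewrite -(@ler_pXn2r _ 2) ?nnegrE ?mulr_ge0 ?enorm_ge0 // exprMn e; lra.
Qed.

End EuclideanNorm.

(** * Growth and gradient of the potential kernel *)

Section PotentialEstimates.
Variable R : realType.
Local Notation a := (@potential_kernel R).
Local Notation nrm := (enorm R).
Local Notation green := (@green R).

Lemma diag_sum1 : diag_sum R 1 = 1 / 4.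
Proof. by rewrite /diag_sum big_nat1 binp1; field. Qed.

(** Stated with max(i+1,j), which is positive, so that the step out of the origin is
covered as well. *)
Lemma green_step_up i j :
  `|green i.+1 j - green i j| <= 80 / (maxn i.+1 j)%:R.
Proof.
have [M0|M0] := posnP (maxn i j).
  have [-> ->] : i = 0%N /\ j = 0%N by lia.
  have := @green_diag R 1 0 isT; rewrite maxn0 exp1n diag_sum1 green00.
  by rewrite subr0 divr1 !ler_norml; lra.
apply: le_trans (green_incr R M0) _.
have p1 : 0 < (maxn i j)%:R :> R by rewrite ltr0n.
have p2 : 0 < (maxn i.+1 j)%:R :> R by rewrite ltr0n; lia.
rewrite ler_pdivrMr // mulrAC ler_pdivlMr //.
have : (maxn i.+1 j)%:R <= 2 * (maxn i j)%:R :> R by rewrite -natrM ler_nat; lia.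
lra.
Qed.

Lemma green_step i i' j : (i <= i'.+1)%N -> (i' <= i.+1)%N ->
  `|green i j - green i' j| <= 80 / (maxn 1 (maxn i j))%:R.
Proof.
move=> h1 h2; have [->|ne] := eqVneq i i'; first by rewrite subrr normr0 divr_ge0.
have aux l : `|green l.+1 j - green l j| <= 80 / (maxn 1 (maxn l j))%:R.
  apply: le_trans (green_step_up l j) _.
  by rewrite ler_pM2l // lef_pV2 ?posrE ?ltr0n ?ler_nat; lia.
have [->|->] : i' = i.+1 \/ i = i'.+1 by lia.
  by rewrite distrC.
apply: le_trans (green_step_up i' j) _.
by rewrite ler_pM2l // lef_pV2 ?posrE ?ltr0n ?ler_nat; lia.
Qed.

Lemma green_near i i' j j' :
  (i <= i'.+1)%N -> (i' <= i.+1)%N -> (j <= j'.+1)%N -> (j' <= j.+1)%N ->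
  `|green i j - green i' j'| <= 240 / (maxn 1 (maxn i j))%:R.
Proof.
move=> h1 h2 h3 h4; rewrite -(subrKA (green i' j)).
apply: le_trans (ler_normD _ _) _.
have s1 := green_step j h1 h2; have s2 := green_step i' h3 h4.
rewrite !(greenC _ _ i') in s2; apply: le_trans (lerD s1 s2) _.
have p1 : 0 < (maxn 1 (maxn i j))%:R :> R by rewrite ltr0n; lia.
have p2 : 0 < (maxn 1 (maxn j i'))%:R :> R by rewrite ltr0n; lia.
have h : (maxn 1 (maxn j i'))%:R^-1 <= 2 / (maxn 1 (maxn i j))%:R :> R.
  rewrite ler_pdivlMr // mulrC ler_pdivrMr // -natrM ler_nat; lia.
lra.
Qed.

Lemma potential_near_even (x y : Z2) (i j : int) :
  x.1 + x.2 = i + i -> x.1 - x.2 = j + j -> ~~ odd (absz (y.1 + y.2)) ->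
  (`|x.1 - y.1| + `|x.2 - y.2| <= 2)%N ->
  `|a x - a y| <= 240 / (maxn 1 (maxn `|i| `|j|))%:R.
Proof.
move=> hi hj /even_coords [i' [j' [hi' hj']]] d.
rewrite (potential_even R hi hj) (potential_even R hi' hj').
by apply: green_near; lia.
Qed.

Lemma mean_close (f : Z2 -> R) (x : Z2) (u e : R) :
  (forall z, z \in nbrs x -> `|u - f z| <= e) ->
  `|u - 4^-1 * \sum_(z <- nbrs x) f z| <= e.
Proof.
move=> h.
have := h (x.1 + 1, x.2); have := h (x.1 - 1, x.2).
have := h (x.1, x.2 + 1); have := h (x.1, x.2 - 1).
rewrite sum_nbrs /nbrs !inE !eqxx ?orbT.
move=> /(_ isT) h1 /(_ isT) h2 /(_ isT) h3 /(_ isT) h4.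
move: h1 h2 h3 h4; rewrite !ler_norml; lra.
Qed.

Lemma parity0 (x : Z2) : odd (absz (x.1 + x.2)) -> x != 0.
Proof. by apply: contraTneq => ->. Qed.

(** Exactly one of x and z is odd. Replacing the value there by the mean over its
neighbours leaves pairs of even sites at l^1 distance at most 2, whose rotated
coordinates differ by at most 1. *)
Lemma potential_grad (x z : Z2) : x != 0 -> z \in nbrs x ->
  `|a x - a z| <= 720 / nrm x.
Proof.
move=> x0 xz; have n1 := enorm_ge1 R x0.
have np : 0 < nrm x by lra.
have pz := nbrs_parity xz.
have [ox|ex] := boolP (odd (absz (x.1 + x.2))).
  have := potential_harmonic R x; rewrite (negbTE x0) addr0 => <-.
  rewrite distrC; apply: mean_close => z' xz'.
  have [i [j [hi hj]]] : exists i j, z.1 + z.2 = i + i /\ z.1 - z.2 = j + j.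
    by apply: even_coords; rewrite pz ox.
  have d : (`|z.1 - z'.1| + `|z.2 - z'.2| <= 2)%N.
    by move: xz xz'; rewrite /nbrs !inE => /or4P[] /eqP -> /or4P[] /eqP -> /=; lia.
  have ez' : ~~ odd (absz (z'.1 + z'.2)) by rewrite (nbrs_parity xz') ox.
  apply: le_trans (potential_near_even hi hj ez' d) _.
  have [hx _] := enorm_nbr R xz; have /andP[_ hz] := enorm_even R hi hj.
  set M := maxn _ _ in hz *.
  have p : 0 < (maxn 1 M)%:R :> R by rewrite ltr0n leq_maxl.
  have p1 : 1 <= (maxn 1 M)%:R :> R by rewrite ler1n leq_maxl.
  have p2 : M%:R <= (maxn 1 M)%:R :> R by rewrite ler_nat leq_maxr.
  rewrite ler_pdivrMr // mulrAC ler_pdivlMr //; lra.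
have oz : odd (absz (z.1 + z.2)) by rewrite pz.
have := potential_harmonic R z; rewrite (negbTE (parity0 oz)) addr0 => <-.
apply: mean_close => z' zz'.
have [i [j [hi hj]]] := even_coords ex.
have d : (`|x.1 - z'.1| + `|x.2 - z'.2| <= 2)%N.
  by move: xz zz'; rewrite /nbrs !inE => /or4P[] /eqP -> /or4P[] /eqP -> /=; lia.
have ez' : ~~ odd (absz (z'.1 + z'.2)) by rewrite (nbrs_parity zz') oz.
apply: le_trans (potential_near_even hi hj ez' d) _.
have /andP[_ hz] := enorm_even R hi hj.
set M := maxn _ _ in hz *.
have p : 0 < (maxn 1 M)%:R :> R by rewrite ltr0n leq_maxl.
have p2 : M%:R <= (maxn 1 M)%:R :> R by rewrite ler_nat leq_maxr.
rewrite ler_pdivrMr // mulrAC ler_pdivlMr //; lra.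
Qed.

Lemma potential_even_ge (x : Z2) : ~~ odd (absz (x.1 + x.2)) ->
  1 - (x == 0)%:R <= a x.
Proof.
move=> /even_coords [i [j [hi hj]]]; have [->|x0] := eqVneq x 0.
  by rewrite potential0 subrr.
rewrite subr0 (potential_even R hi hj) green_ge1 //.
by move: x0 hi hj; case: x => u v /=; rewrite xpair_eqE negb_and => /orP[]; lia.
Qed.

(** At an even site the term of time 0 already contributes 1. An odd site is the mean
of four even ones, of which at most one is the origin. *)
Lemma potential_lb (x : Z2) : x != 0 -> 3 / 4 <= a x.
Proof.
move=> x0; have [ox|ex] := boolP (odd (absz (x.1 + x.2))); last first.
  by have := potential_even_ge ex; rewrite (negbTE x0) subr0; lra.
have := potential_harmonic R x; rewrite (negbTE x0) addr0 => <-.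
have ev z : z \in nbrs x -> 1 - (z == 0)%:R <= a z.
  by move=> xz; apply: potential_even_ge; rewrite (nbrs_parity xz) ox.
have := ev (x.1 + 1, x.2); have := ev (x.1 - 1, x.2).
have := ev (x.1, x.2 + 1); have := ev (x.1, x.2 - 1).
rewrite sum_nbrs /nbrs !inE !eqxx ?orbT.
move=> /(_ isT) h1 /(_ isT) h2 /(_ isT) h3 /(_ isT) h4.
set b1 := (_ == 0) in h1; set b2 := (_ == 0) in h2.
set b3 := (_ == 0) in h3; set b4 := (_ == 0) in h4.
have : (b1 + b2 + b3 + b4 <= 1)%N.
  rewrite /b1 /b2 /b3 /b4 !xpair_eqE; move: (x.1) (x.2); clear => u v.
  by case: (u =P 0) => [->|_]; case: (v =P 0) => [->|_]; lia.
rewrite -(ler_nat R) !natrD; lra.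
Qed.

Lemma ln2_le1 : ln 2 <= 1 :> R.
Proof. by have := @le_ln1Dx R 1; rewrite (_ : 1 + 1 = 2) //; apply; lra. Qed.

(** An odd site is compared with its neighbour further away from the origin, which is
even and different from the origin. *)
Lemma potential_size (x : Z2) : x != 0 -> exists M : nat,
  [/\ (0 < M)%N, `|a x - diag_sum R (M ^ 2)| <= 728 & `|ln M%:R - ln (nrm x)| <= 1].
Proof.
move=> x0; have n1 := enorm_ge1 R x0.
have lnb (M : nat) : (0 < M)%N -> M%:R <= 2 * nrm x -> nrm x <= 2 * M%:R ->
    `|ln M%:R - ln (nrm x)| <= 1.
  move=> M0 h1 h2; have Mp : 0 < M%:R :> R by rewrite ltr0n.
  have l1 : ln M%:R <= ln 2 + ln (nrm x).
    by rewrite -lnM ?ler_ln ?posrE //; lra.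
  have l2 : ln (nrm x) <= ln 2 + ln M%:R.
    rewrite -lnM ?ler_ln ?posrE //; lra.
  by have := ln2_le1; rewrite ler_norml; lra.
have even_case (z : Z2) : z != 0 -> ~~ odd (absz (z.1 + z.2)) -> exists M : nat,
  [/\ (0 < M)%N, `|a z - diag_sum R (M ^ 2)| <= 8, M%:R <= nrm z & nrm z <= 2 * M%:R].
  move=> z0 /even_coords [i [j [hi hj]]]; exists (maxn `|i| `|j|).
  have /andP[h1 h2] := enorm_even R hi hj.
  have M0 : (0 < maxn `|i| `|j|)%N.
    by move: z0 hi hj; case: z {h1 h2} => u v /=; rewrite xpair_eqE negb_and => /orP[]; lia.
  by split=> //; rewrite (potential_even R hi hj) green_diag.
have [ox|ex] := boolP (odd (absz (x.1 + x.2))); last first.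
  have [M [M0 hM h1 h2]] := even_case _ x0 ex.
  exists M; split=> //; first by lra.
  by apply: lnb => //; lra.
pose z : Z2 := (if 0 <= x.1 then x.1 + 1 else x.1 - 1, x.2).
have xz : z \in nbrs x by rewrite /z /nbrs !inE; case: ifP; rewrite eqxx ?orbT.
have hnz : nrm x <= nrm z.
  rewrite -(@ler_pXn2r _ 2) ?nnegrE ?enorm_ge0 // !enorm_sqr /= lerD2r.
  case: (lerP 0 x.1) => h.
    have : 0 <= x.1%:~R :> R by rewrite ler0z.
    rewrite rmorphD /=; set u := x.1%:~R; nra.
  have : x.1%:~R <= 0 :> R by rewrite lerz0 ltW.
  rewrite rmorphB /=; set u := x.1%:~R; nra.
have [_ hz] := enorm_nbr R xz.
have z0 : z != 0 by apply: contraTneq hnz => ->; rewrite enorm0; lra.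
have ez : ~~ odd (absz (z.1 + z.2)) by rewrite (nbrs_parity xz) ox.
have [M [M0 hM h1 h2]] := even_case _ z0 ez.
exists M; split=> //; last by apply: lnb => //; lra.
have := potential_grad x0 xz.
have : 720 / nrm x <= 720 by rewrite ler_pdivrMr; lra.
move: hM; rewrite !ler_norml; lra.
Qed.

Lemma ln_sqrn (M : nat) : (0 < M)%N -> ln (M ^ 2)%N%:R = 2 * ln M%:R :> R.
Proof. by move=> M0; rewrite natrX lnXn ?ltr0n // mulr_natl. Qed.

Lemma potential_log_diff (x y : Z2) : x != 0 -> y != 0 ->
  `|a x - a y| <= 1500 + `|ln (nrm x) - ln (nrm y)|.
Proof.
move=> x0 y0.
have [M [M0 hM lM]] := potential_size x0; have [M' [M0' hM' lM']] := potential_size y0.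
have key (K K' : nat) : (0 < K)%N -> (K <= K')%N ->
    `|diag_sum R (K ^ 2) - diag_sum R (K' ^ 2)| <= `|ln K%:R - ln K'%:R|.
  move=> K0 KK; have K20 : (0 < K ^ 2)%N by rewrite expn_gt0 K0.
  have KK2 : (K ^ 2 <= K' ^ 2)%N by rewrite leq_exp2r.
  have := diag_sum_ub R K20 KK2; rewrite !ln_sqrn //; last by lia.
  move=> /andP[g1 g2]; rewrite distrC ger0_norm // distrC.
  apply: le_trans g2 _; apply: le_trans (ler_norm _); lra.
have {}key : `|diag_sum R (M ^ 2) - diag_sum R (M' ^ 2)| <= `|ln M%:R - ln M'%:R|.
  have [h|h] := orP (leq_total M M'); first exact: key.
  by rewrite distrC [leRHS]distrC key.
have h1 : `|ln M%:R - ln M'%:R| <= 2 + `|ln (nrm x) - ln (nrm y)|.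
  set r := `|ln (nrm x) - _|.
  have : - r <= ln (nrm x) - ln (nrm y) <= r by rewrite -ler_norml.
  by move: lM lM'; rewrite !ler_norml; lra.
have := le_trans key h1; set r := `|ln (nrm x) - _|.
by move: hM hM'; rewrite !ler_norml; lra.
Qed.

Lemma potential_ln_lb (x : Z2) : x != 0 -> ln (nrm x) / 2 - 729 <= a x.
Proof.
move=> x0; have [M [M0 hM lM]] := potential_size x0.
have := diag_sum_lb R (M ^ 2).
have Mp : 0 < (M ^ 2)%:R :> R by rewrite ltr0n expn_gt0 M0.
have : ln (M ^ 2)%N%:R <= ln (M ^ 2).+1%:R :> R.
  by rewrite ler_ln ?posrE // ler_nat.
rewrite ln_sqrn //; move: hM lM; rewrite !ler_norml; lra.
Qed.

End PotentialEstimates.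

(** * Hitting function and transience of the conditioned walk *)

Section HittingFunction.
Variable R : realType.
Local Notation a := (@potential_kernel R).
Local Notation Q := (@cond_trans R).
Local Notation nrm := (enorm R).

Lemma potential_ge0 x : 0 <= a x.
Proof.
by have [->|/(potential_lb R)] := eqVneq x 0; [rewrite potential0|lra].
Qed.

Lemma potential_gt0 x : x != 0 -> 0 < a x.
Proof. by move/(potential_lb R); lra. Qed.

Lemma cond_trans_ge0 x z : 0 <= Q x z.
Proof.
rewrite /cond_trans; case: ifP => // _.
by rewrite divr_ge0 ?mulr_ge0 ?potential_ge0.
Qed.

Lemma cond_trans0 x : Q x 0 = 0.
Proof. by rewrite /cond_trans potential0 mul0r if_same. Qed.

Lemma cond_stepE (f : Z2 -> R) x : x != 0 ->
  \sum_(z <- nbrs x) Q x z * f z = (4 * a x)^-1 * \sum_(z <- nbrs x) a z * f z.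
Proof.
move=> x0; rewrite mulr_sumr; apply: eq_big_seq => z xz.
by rewrite /cond_trans x0 /adj xz /= mulrAC mulrC.
Qed.

Lemma cond_trans_sum1 x : x != 0 -> \sum_(z <- nbrs x) Q x z = 1.
Proof.
move=> x0; under eq_bigr do rewrite -[Q _ _]mulr1.
rewrite cond_stepE //; under eq_bigr do rewrite mulr1.
have := potential_harmonic R x; rewrite (negbTE x0) addr0 => h.
have ax := potential_gt0 x0.
by rewrite invfM mulrAC h mulfV // gt_eqF.
Qed.

(** The probability that the conditioned walk started at x ever visits y: the ratio of
its Green functions at (x,y) and (y,y), where a(x) + a(y) - a(x-y) is the Green
function of the simple random walk killed at the origin. *)
Definition hit (y x : Z2) : R := (a x + a y - a (x - y)) / (2 * a x).

(** Both sides vanish at z = 0, so the sites next to the origin are no exception in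
[hit_step]. *)
Lemma potential_hit y z : y != 0 -> a z * hit y z = (a z + a y - a (z - y)) / 2.
Proof.
move=> y0; have [->|z0] := eqVneq z 0.
  by rewrite potential0 sub0r potentialN add0r subrr !mul0r.
by rewrite /hit; field; rewrite gt_eqF // potential_gt0.
Qed.

Lemma hit_self y : y != 0 -> hit y y = 1.
Proof.
move=> y0; rewrite /hit subrr potential0 subr0.
by field; rewrite gt_eqF // potential_gt0.
Qed.

Lemma hit_step y x : x != 0 -> y != 0 ->
  \sum_(z <- nbrs x) Q x z * hit y z = hit y x - (x == y)%:R / (2 * a y).
Proof.
move=> x0 y0; rewrite cond_stepE //.
under eq_bigr do rewrite potential_hit //.
have hx := potential_harmonic R x; rewrite (negbTE x0) addr0 in hx.
have hxy := potential_harmonic R (x - y); rewrite subr_eq0 in hxy.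
have e : \sum_(z <- nbrs (x - y)) a z = \sum_(z <- nbrs x) a (z - y).
  rewrite !sum_nbrs; congr (a _ + a _ + a _ + a _); apply/eqP;
    rewrite xpair_eqE /=; lia.
rewrite -mulr_suml sumrB big_split /= -e.
have -> : \sum_(z <- nbrs x) a y = 4 * a y by rewrite sum_nbrs; ring.
have -> : \sum_(z <- nbrs x) a z = 4 * a x by rewrite -hx; field.
have -> : \sum_(z <- nbrs (x - y)) a z = 4 * (a (x - y) + (x == y)%:R).
  by rewrite -hxy; field.
have ax := potential_gt0 x0; have ay := potential_gt0 y0.
rewrite /hit; have [->|xy] := eqVneq x y.
  by rewrite mulr1n; field; rewrite gt_eqF.
by rewrite mulr0n mul0r addr0; field; rewrite gt_eqF.
Qed.

(** The increment of a over the fixed vector y is bounded, because |x| and |x-y| differ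
at most by a factor 1 + |y|. *)
Lemma hit_bound y : y != 0 -> exists C : R, [/\ 0 <= C &
  forall x, x != 0 -> `|hit y x| <= C / a x].
Proof.
move=> y0; exists (a y + 1500 + ln (1 + nrm y)).
have ny := enorm_ge1 R y0.
have l0 : 0 <= ln (1 + nrm y) by apply: ln_ge0; lra.
have ay := potential_gt0 y0.
split=> [|x x0]; first by lra.
have ax := potential_gt0 x0.
have nx := enorm_ge1 R x0.
rewrite /hit normrM [X in _ * X]gtr0_norm ?invr_gt0 ?mulr_gt0 //.
rewrite invfM mulrA ler_pM2r ?invr_gt0 //.
have : `|a x - a (x - y)| <= a y + 1500 + ln (1 + nrm y).
  have [->|xy] := eqVneq x y.
    by rewrite subrr potential0 subr0 ger0_norm; lra.
  have xy0 : x - y != 0 by rewrite subr_eq0.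
  apply: le_trans (potential_log_diff R x0 xy0) _.
  have nxy := enorm_ge1 R xy0.
  have t1 : nrm x <= nrm (x - y) + nrm y.
    by have := enorm_triangle R (x - y) y; rewrite subrK.
  have t2 : nrm (x - y) <= nrm x + nrm y.
    by have := enorm_triangle R x (- y); rewrite enormN.
  have l1 : ln (nrm x) <= ln (1 + nrm y) + ln (nrm (x - y)).
    rewrite -lnM ?ler_ln ?posrE ?mulr_gt0 //; nra.
  have l2 : ln (nrm (x - y)) <= ln (1 + nrm y) + ln (nrm x).
    rewrite -lnM ?ler_ln ?posrE ?mulr_gt0 //; nra.
  suff : `|ln (nrm x) - ln (nrm (x - y))| <= ln (1 + nrm y) by lra.
  rewrite ler_norml; lra.
rewrite !ler_norml => /andP[h1 h2].
rewrite -(ger0_norm (_ : 0 <= 2^-1)) // -normrM ler_norml; lra.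
Qed.

Fixpoint chain_exp (t : nat) (f : Z2 -> R) (x : Z2) : R :=
  if t is t'.+1 then \sum_(z <- nbrs x) Q x z * chain_exp t' f z else f x.

Lemma chain_exp_le t f g x : x != 0 -> (forall z, z != 0 -> f z <= g z) ->
  chain_exp t f x <= chain_exp t g x.
Proof.
move=> x0 fg; elim: t x x0 => [|t ih] x x0 /=; first exact: fg.
apply: ler_sum => z _; have [->|z0] := eqVneq z 0; first by rewrite cond_trans0 !mul0r.
by rewrite ler_wpM2l ?cond_trans_ge0 // ih.
Qed.

Lemma chain_expD t f g x :
  chain_exp t (fun z => f z + g z) x = chain_exp t f x + chain_exp t g x.
Proof.
elim: t x => [|t ih] x //=; rewrite -big_split /=; apply: eq_bigr => z _.
by rewrite ih mulrDr.
Qed.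

Lemma chain_expZ t c f x : chain_exp t (fun z => c * f z) x = c * chain_exp t f x.
Proof.
elim: t x => [|t ih] x //=; rewrite mulr_sumr; apply: eq_bigr => z _.
by rewrite ih mulrCA.
Qed.

Lemma chain_exp_cst t c x : x != 0 -> chain_exp t (fun=> c) x = c.
Proof.
elim: t x => [|t ih] x //= x0.
rewrite (eq_big_seq (fun z => Q x z * c)); last first.
  move=> z _; have [->|z0] := eqVneq z 0; first by rewrite cond_trans0 !mul0r.
  by rewrite ih.
by rewrite -mulr_suml cond_trans_sum1 // mul1r.
Qed.

Lemma chain_exp_ge0 t f x : x != 0 -> (forall z, z != 0 -> 0 <= f z) ->
  0 <= chain_exp t f x.
Proof. by move=> x0 f0; rewrite -[leLHS](chain_exp_cst t 0 x0) chain_exp_le. Qed.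

Lemma chain_exp_sum t (I : Type) (r : seq I) (f : I -> Z2 -> R) x : x != 0 ->
  chain_exp t (fun z => \sum_(i <- r) f i z) x = \sum_(i <- r) chain_exp t (f i) x.
Proof.
move=> x0; elim: r => [|i r ih].
  under [in LHS]eq_fun do rewrite big_nil.
  by rewrite chain_exp_cst // big_nil.
under [in LHS]eq_fun do rewrite big_cons.
by rewrite chain_expD ih big_cons.
Qed.

Lemma chain_exp_stepr t f x :
  chain_exp t.+1 f x = chain_exp t (fun w => \sum_(z <- nbrs w) Q w z * f z) x.
Proof.
elim: t x => [|t ih] x //; rewrite [LHS]/= [RHS]/=.
by apply: eq_bigr => z _; rewrite -ih.
Qed.

Lemma eq_chain_exp t f g x : x != 0 -> (forall z, z != 0 -> f z = g z) ->
  chain_exp t f x = chain_exp t g x.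
Proof.
by move=> x0 fg; apply/eqP; rewrite eq_le !chain_exp_le // => z z0; rewrite fg.
Qed.

(** By [hit_step] each visit to y lowers the mean of [hit y] by (2 a(y))^-1, so the
expected number of visits telescopes. *)
Lemma chain_visits (y x : Z2) T : x != 0 -> y != 0 ->
  \sum_(0 <= t < T) chain_exp t (fun w => (w == y)%:R) x =
  2 * a y * (hit y x - chain_exp T (hit y) x).
Proof.
move=> x0 y0; have ay := potential_gt0 y0.
elim: T => [|T ih]; first by rewrite big_geq //= subrr mulr0.
rewrite chain_exp_stepr big_nat_recr //= ih.
rewrite [X in _ = _ * (_ - X)](_ : _ =
    chain_exp T (fun w => hit y w + - (2 * a y)^-1 * (w == y)%:R) x); last first.
  apply: eq_chain_exp => // z z0.
  by rewrite hit_step // mulNr [in RHS]mulrC.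
rewrite chain_expD chain_expZ; field; rewrite gt_eqF //.
Qed.

Lemma chain_transient (y x : Z2) : x != 0 -> y != 0 ->
  chain_exp t (fun w => (w == y)%:R) x @[t --> \oo] --> (0 : R).
Proof.
move=> x0 y0; apply: cvg_series_cvg_0.
have [C [C0 hC]] := hit_bound y0; have ay := potential_gt0 y0.
have hC' z : z != 0 -> `|hit y z| <= C * (4 / 3).
  move=> z0; apply: le_trans (hC _ z0) _; apply: ler_wpM2l => //.
  rewrite -[leRHS]invrK lef_pV2 ?posrE ?potential_gt0 // invf_div.
  exact: potential_lb.
have t0 t : 0 <= chain_exp t (fun w => (w == y)%:R) x by apply: chain_exp_ge0.
apply: nondecreasing_is_cvgn.
  move=> m n mn; rewrite !seriesEnat /= [leRHS](big_cat_nat _ (n := m)) //=.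
  by rewrite lerDl sumr_ge0.
exists (2 * a y * (2 * (C * (4 / 3)))) => _ [T _ <-].
rewrite seriesEnat /= chain_visits // ler_pM2l ?mulr_gt0 //.
have h1 : hit y x <= C * (4 / 3) by apply: le_trans (ler_norm _) (hC' _ x0).
have h2 : - (C * (4 / 3)) <= chain_exp T (hit y) x.
  rewrite -[leLHS](chain_exp_cst T _ x0); apply: chain_exp_le => // z z0.
  by have := hC' _ z0; rewrite ler_norml => /andP[].
lra.
Qed.

Definition box (m : nat) : seq Z2 :=
  [seq (i%:Z - m%:Z, j%:Z - m%:Z) | i <- iota 0 (m + m).+1, j <- iota 0 (m + m).+1].

Lemma mem_box m (z : Z2) : nrm z <= m%:R -> z \in box m.
Proof.
move=> h; have sq : z.1%:~R ^+ 2 + z.2%:~R ^+ 2 <= m%:R ^+ 2 :> R.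
  by rewrite -enorm_sqr lerXn2r ?nnegrE ?enorm_ge0.
have aux (u v : int) : u%:~R ^+ 2 + v%:~R ^+ 2 <= m%:R ^+ 2 :> R -> - m%:Z <= u <= m%:Z.
  move=> huv; have {}huv : `|u%:~R| <= m%:R :> R.
    rewrite -(@ler_pXn2r _ 2) ?nnegrE // real_normK ?num_real //.
    have := sqr_ge0 (v%:~R : R); lra.
  have : `|u| <= m%:Z by rewrite -(ler_int R) intr_norm.
  by rewrite ler_norml.
have h1 := aux _ _ sq; have h2 : - m%:Z <= z.2 <= m%:Z by apply: (aux _ z.1); rewrite addrC.
apply/allpairsP; exists (absz (z.1 + m%:Z), absz (z.2 + m%:Z)); split.
- by rewrite mem_iota /=; lia.
- by rewrite mem_iota /=; lia.
apply/eqP; case: z h1 h2 {h sq} => u v /= h1 h2.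
by rewrite xpair_eqE; lia.
Qed.

Lemma cvg_sum0 (I : eqType) (s : seq I) (f : I -> nat -> R) :
  (forall i, i \in s -> f i @ \oo --> (0 : R)) ->
  \sum_(i <- s) f i t @[t --> \oo] --> (0 : R).
Proof.
elim: s => [|i s ih] hs.
  rewrite (_ : (fun t => \sum_(j <- [::]) f j t) = (fun=> 0)); first exact: cvg_cst.
  by apply/funext => t; rewrite big_nil.
rewrite (_ : (fun t => \sum_(j <- i :: s) f j t) =
             (fun t => f i t + \sum_(j <- s) f j t)); last first.
  by apply/funext => t; rewrite big_cons.
have h1 : f i @ \oo --> (0 : R) by apply: hs; rewrite inE eqxx.
have h2 : \sum_(j <- s) f j t @[t --> \oo] --> (0 : R).
  by apply: ih => j js; apply: hs; rewrite inE js orbT.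
have := cvgD h1 h2; rewrite addr0; exact.
Qed.

(** Outside a large box [hit y] is small, being O(1/a); and each of the finitely many
sites of the box is occupied at time t with vanishing probability. *)
Lemma hit_vanishes (y x : Z2) : x != 0 -> y != 0 ->
  chain_exp t (fun w => `|hit y w|) x @[t --> \oo] --> (0 : R).
Proof.
move=> x0 y0; have [C [C0 hC]] := hit_bound y0.
apply/cvgr0Pnorm_le => e e0.
pose m := (Num.truncn (expR (2 * (729 + 2 * C / e)))).+1.
pose s := [seq z <- box m | z != 0].
have hb w : w != 0 -> `|hit y w| <= e / 2 + C * (4 / 3) * \sum_(z <- s) (w == z)%:R.
  move=> w0; apply: le_trans (hC _ w0) _.
  have aw := potential_gt0 w0; have al := potential_lb R w0.
  have s0 : 0 <= \sum_(z <- s) (w == z)%:R :> R by apply: sumr_ge0.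
  have [hw|hw] := lerP (nrm w) m%:R.
    have ws : w \in s by rewrite mem_filter w0 mem_box.
    have s1 : 1 <= \sum_(z <- s) (w == z)%:R :> R.
      by rewrite (big_rem _ ws) /= eqxx lerDl sumr_ge0.
    have : C / a w <= C * (4 / 3).
      by rewrite ler_wpM2l // -[leRHS]invrK lef_pV2 ?posrE // invf_div.
    have : C * (4 / 3) <= C * (4 / 3) * \sum_(z <- s) (w == z)%:R.
      by rewrite ler_peMr // mulr_ge0.
    lra.
  have hln : 2 * (729 + 2 * C / e) <= ln (nrm w).
    rewrite -[leLHS]expRK ler_ln ?posrE ?expR_gt0 //; last first.
      by have := enorm_ge1 R w0; lra.
    apply: le_trans (ltW hw); apply: ltW.
    by rewrite /m; case/andP: (truncn_itv (expR_ge0 (2 * (729 + 2 * C / e)))).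
  have ha : 2 * C / e <= a w by have := potential_ln_lb R w0; lra.
  have : C / a w <= e / 2.
    by rewrite ler_pdivrMr //; move: ha; rewrite ler_pdivrMr //; lra.
  have : 0 <= C * (4 / 3) * \sum_(z <- s) (w == z)%:R by rewrite !mulr_ge0.
  lra.
have hs : C * (4 / 3) * \sum_(z <- s) chain_exp t (fun w => (w == z)%:R) x @[t --> \oo]
    --> (0 : R).
  have h : \sum_(z <- s) chain_exp t (fun w => (w == z)%:R) x @[t --> \oo] --> (0 : R).
    apply: cvg_sum0 => z; rewrite mem_filter => /andP[z0 _].
    exact: chain_transient.
  have := @cvgMr _ _ _ _ _ (C * (4 / 3)) _ h; rewrite mulr0; exact.
have e20 : 0 < e / 2 by lra.
move/cvgr0Pnorm_le : hs => /(_ _ e20); apply: filterS => t ht.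
rewrite ger0_norm; last by apply: chain_exp_ge0.
apply: le_trans (chain_exp_le t x0 hb) _.
rewrite chain_expD chain_exp_cst // chain_expZ chain_exp_sum //.
by have := le_trans (ler_norm _) ht; lra.
Qed.

End HittingFunction.

(** * An approximate martingale for the number of unvisited sites *)

Section UnvisitedSites.
Variable R : realType.
Local Notation a := (@potential_kernel R).
Local Notation Q := (@cond_trans R).
Local Notation hit := (@hit R).
Local Notation chain_exp := (@chain_exp R).

(** The position together with the set of unvisited sites is a Markov chain; this is
its expectation operator after t steps. *)
Fixpoint state_exp (t : nat) (Phi : Z2 -> {fset Z2} -> R) (x : Z2) (B : {fset Z2}) : R :=
  if t is t'.+1 then \sum_(z <- nbrs x) Q x z * state_exp t' Phi z (B `\ z)%fset
  else Phi x B.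

Definition below (j k : nat) : R := (k < j)%N%:R.

(** The solution of [slope_rec] that vanishes below j. *)
Definition slope (j k : nat) : R :=
  if (k < j)%N then 0 else - (2 * j%:R / (k%:R * (k%:R + 1))).

(** The total variation of [slope j] on [0,k]: a jump of size 2/(j+1) at j, followed by
a monotone return towards 0. *)
Definition slope_var (j k : nat) : R :=
  if (k < j)%N then 0 else 4 / (j%:R + 1) + slope j k.

(** The drift of [corrector] at a visit that leaves k sites, when [hit_sum] is exactly
k/2 after the visit: the sum of the change of [below j], of the loss of one unit in
[hit_sum], and of the change of slope. *)
Lemma slope_rec j k : (0 < j)%N ->
  below j k - below j k.+1 + slope j k.+1 - k%:R / 2 * (slope j k - slope j k.+1) = 0.
Proof.
move=> j0; have jp : 0 < j%:R :> R by rewrite ltr0n.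
rewrite /below /slope; have [h1|h1] := ltnP k.+1 j.
  by rewrite ltnW //; ring.
have [h2|h2] := ltnP k j.
  have -> : j = k.+1 by lia.
  have k0 : 0 <= k%:R :> R by [].
  by rewrite mulr1n mulr0n -natr1; field; lra.
have kp : 0 < k%:R :> R by rewrite ltr0n; lia.
by rewrite mulr0n -natr1; field; lra.
Qed.

Lemma slope_diff j k : (0 < j)%N ->
  `|slope j k - slope j k.+1| <= slope_var j k.+1 - slope_var j k.
Proof.
move=> j0; have jp : 0 < j%:R :> R by rewrite ltr0n.
rewrite /slope_var /slope; have [h1|h1] := ltnP k.+1 j.
  by rewrite ltnW // !subrr normr0.
have [h2|h2] := ltnP k j.
  have -> : j = k.+1 by lia.
  have p : 0 < k.+1%:R :> R by rewrite ltr0n.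
  move: p; set m := k.+1%:R => p.
  rewrite sub0r opprK ger0_norm.
    by rewrite le_eqVlt; apply/orP; left; apply/eqP; field; lra.
  by rewrite mulr_ge0 ?mulr_ge0 ?invr_ge0 ?mulr_ge0; lra.
have kp : 0 < k%:R :> R by rewrite ltr0n; lia.
have e1 : k.+1%:R = k%:R + 1 :> R by rewrite natr1.
rewrite e1; set b := 2 * j%:R.
have h : b / ((k%:R + 1) * (k%:R + 1 + 1)) <= b / (k%:R * (k%:R + 1)).
  rewrite /b ler_pM2l ?mulr_gt0 // lef_pV2 ?posrE ?mulr_gt0 //; nra.
rewrite ler_norml; lra.
Qed.

Lemma slope_bound j k : (0 < j)%N -> `|slope j k| <= 4 / (j%:R + 1).
Proof.
move=> j0; have jp : 0 < j%:R :> R by rewrite ltr0n.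
have j1 : 1 <= j%:R :> R by rewrite ler1n.
rewrite /slope; have [h1|h1] := ltnP k j; first by rewrite normr0 divr_ge0; lra.
have kj : j%:R <= k%:R :> R by rewrite ler_nat.
rewrite normrN ger0_norm; last by rewrite divr_ge0 ?mulr_ge0; lra.
rewrite ler_pdivrMr ?mulr_gt0; [|lra..].
rewrite mulrAC ler_pdivlMr; last by lra.
nra.
Qed.

Lemma slope_var_bounds j k : (0 < j)%N -> 0 <= slope_var j k <= 4 / (j%:R + 1).
Proof.
move=> j0; have jp : 0 < j%:R :> R by rewrite ltr0n.
have := slope_bound k j0; rewrite ler_norml /slope_var => /andP[h1 h2].
case: ltnP => h; first by rewrite lexx divr_ge0; lra.
rewrite -lerBlDl sub0r h1 /= gerDl /slope ltnNge h /= oppr_le0.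
by rewrite divr_ge0 // mulr_ge0 //; lra.
Qed.

Definition hit_sum (x : Z2) (B : {fset Z2}) : R := \sum_(y <- B) hit y x.

(** If [hit_sum] were half of the number of unvisited sites at present and after every
later visit, this would be the conditional probability that fewer than j sites stay
unvisited forever, namely j/(k+1) when k >= j sites are unvisited. *)
Definition corrector (j : nat) (x : Z2) (B : {fset Z2}) : R :=
  below j #|` B| - hit_sum x B * slope j #|` B|.

Variables (A : {fset Z2}) (eta : R).
Hypothesis A0 : 0 \notin A.
Hypothesis eta0 : 0 <= eta.
Hypothesis hit_half : forall z (B : {fset Z2}), z \in A -> (B `<=` A `\ z)%fset ->
  `|hit_sum z B - #|` B|%:R / 2| <= eta.

Definition reachable (x : Z2) (B : {fset Z2}) : Prop :=
  [/\ x != 0, x \notin B & (B `<=` A)%fset].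

Lemma reachable_step x B z : reachable x B -> z != 0 -> reachable z (B `\ z)%fset.
Proof.
move=> [x0 xB BA] z0; split=> //; first by rewrite !inE eqxx.
exact: fsubset_trans (fsubD1set _ _) BA.
Qed.

Lemma state_exp_le t Phi Psi x B : reachable x B ->
  (forall z C, reachable z C -> Phi z C <= Psi z C) ->
  state_exp t Phi x B <= state_exp t Psi x B.
Proof.
move=> xB h; elim: t x B xB => [|t ih] x B xB /=; first exact: h.
apply: ler_sum => z _; have [->|z0] := eqVneq z 0; first by rewrite cond_trans0 !mul0r.
by rewrite ler_wpM2l ?cond_trans_ge0 // ih //; apply: reachable_step xB z0.
Qed.

Lemma state_expD t Phi Psi x B :
  state_exp t (fun z C => Phi z C + Psi z C) x B = state_exp t Phi x B + state_exp t Psi x B.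
Proof.
elim: t x B => [|t ih] x B //=; rewrite -big_split /=; apply: eq_bigr => z _.
by rewrite ih mulrDr.
Qed.

Lemma state_expN t Phi x B :
  state_exp t (fun z C => - Phi z C) x B = - state_exp t Phi x B.
Proof.
elim: t x B => [|t ih] x B //=; rewrite -sumrN; apply: eq_bigr => z _.
by rewrite ih mulrN.
Qed.

Lemma state_exp_chain t f x B : state_exp t (fun z _ => f z) x B = chain_exp t f x.
Proof. by elim: t x B => [|t ih] x B //=; apply: eq_bigr => z _; rewrite ih. Qed.

Lemma state_exp_supermartingale t G x B : reachable x B ->
  (forall x B, reachable x B -> \sum_(z <- nbrs x) Q x z * G z (B `\ z)%fset <= G x B) ->
  state_exp t G x B <= G x B.
Proof.
move=> xB h; elim: t x B xB => [|t ih] x B xB //=.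
apply: le_trans (h _ _ xB); apply: ler_sum => z _.
have [->|z0] := eqVneq z 0; first by rewrite cond_trans0 !mul0r.
by rewrite ler_wpM2l ?cond_trans_ge0 // ih //; apply: reachable_step xB z0.
Qed.

(** By [slope_rec] the drift caused by a visit vanishes if [hit_sum] is half of the
number of remaining sites. What is left is the deviation from one half, at most eta,
times the increment of the slope. *)
Lemma corrector_jump j z B : (0 < j)%N -> (B `<=` A)%fset ->
  `|corrector j z (B `\ z)%fset - (below j #|` B| - hit_sum z B * slope j #|` B|)|
  <= eta * (slope_var j #|` B| - slope_var j #|` B `\ z|%fset).
Proof.
move=> j0 BA; have [zB|zB] := boolP (z \in B); last first.
  have -> : (B `\ z = B)%fset by apply/mem_fsetD1.
  by rewrite !subrr normr0 mulr0.
have zA : z \in A by apply: (fsubsetP BA).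
have z0 : z != 0 by apply: contraNneq A0 => <-.
have hB : hit_sum z B = 1 + hit_sum z (B `\ z)%fset.
  by rewrite /hit_sum (big_fsetD1 z zB) /= hit_self.
have sub : (B `\ z `<=` A `\ z)%fset by apply: fsetSD.
have := hit_half zA sub.
rewrite hB /corrector (cardfsD1 z B) zB add1n.
set k := #|` _|; set h := hit_sum _ _ => hk.
have e := slope_rec k j0.
rewrite (_ : _ - _ = - ((h - k%:R / 2) * (slope j k - slope j k.+1))); last first.
  apply/eqP; rewrite -subr_eq0 -[X in _ == X]e; apply/eqP; ring.
by rewrite normrN normrM ler_pM ?slope_diff.
Qed.

(** Off the unvisited set [hit_sum] is harmonic, so the mean of the corrector changes
only through visits. *)
Lemma corrector_step j x B : (0 < j)%N -> reachable x B ->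
  `|\sum_(z <- nbrs x) Q x z * corrector j z (B `\ z)%fset - corrector j x B| <=
  eta * (slope_var j #|` B| - \sum_(z <- nbrs x) Q x z * slope_var j #|` B `\ z|%fset).
Proof.
move=> j0 [x0 xB BA].
have e1 : corrector j x B = \sum_(z <- nbrs x) Q x z *
    (below j #|` B| - hit_sum z B * slope j #|` B|).
  under eq_bigr do rewrite mulrBr mulrA.
  rewrite sumrB -!mulr_suml cond_trans_sum1 // mul1r /corrector; congr (_ - _ * _).
  rewrite /hit_sum; under [RHS]eq_bigr do rewrite mulr_sumr.
  rewrite exchange_big /= [LHS]big_seq [RHS]big_seq; apply: eq_bigr => y yB.
  have y0 : y != 0 by apply: contraNneq A0 => <-; apply: (fsubsetP BA).
  rewrite hit_step // (negbTE (_ : x != y)) ?mulr0n ?mul0r ?subr0 //.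
  by apply: contraNneq xB => ->.
have e2 : slope_var j #|` B| = \sum_(z <- nbrs x) Q x z * slope_var j #|` B|.
  by rewrite -mulr_suml cond_trans_sum1 // mul1r.
rewrite e1 e2 -!sumrB; apply: le_trans (ler_norm_sum _ _ _) _.
rewrite mulr_sumr; apply: ler_sum => z _.
rewrite -!mulrBr normrM ger0_norm ?cond_trans_ge0 // mulrCA.
by rewrite ler_wpM2l ?cond_trans_ge0 ?corrector_jump.
Qed.

(** Sites never become unvisited again, so the error of each step is paid for by the
decrease of [slope_var]: the corrector with either sign, plus eta times [slope_var],
is a supermartingale. This makes the bound uniform in t. *)
Lemma corrector_exp t j x B : (0 < j)%N -> reachable x B ->
  `|state_exp t (corrector j) x B - corrector j x B| <= eta * (4 / (j%:R + 1)).
Proof.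
move=> j0 xB.
have vB (C : {fset Z2}) := slope_var_bounds #|` C| j0.
(* The sign (-1)^s gives the upper and the lower bound at once. *)
pose W (s : bool) z C := (-1) ^+ s * corrector j z C + eta * slope_var j #|` C|.
have sW (s : bool) : state_exp t (W s) x B <= W s x B.
  apply: state_exp_supermartingale => // {}x {}B {}xB.
  have := corrector_step j0 xB; rewrite /W.
  under [X in _ -> X <= _]eq_bigr do rewrite mulrDr mulrCA [Q _ _ * (eta * _)]mulrCA.
  rewrite big_split -!mulr_sumr /=.
  set u := \sum_(_ <- _) _; set v := \sum_(_ <- _) _.
  by rewrite ler_norml; case: s; rewrite ?expr1 ?expr0; lra.
have leW (s : bool) : state_exp t (fun z C => (-1) ^+ s * corrector j z C) x B <= W s x B.
  apply: le_trans (sW s); apply: state_exp_le => // z C _.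
  by rewrite lerDl mulr_ge0 //; case/andP: (vB C).
have /andP[v0 v1] := vB B.
have := leW false; have := leW true; rewrite /W !expr1 !expr0.
rewrite (_ : (fun z C => -1 * corrector j z C) = (fun z C => - corrector j z C)); last first.
  by apply/funext => z; apply/funext => C; rewrite mulN1r.
rewrite (_ : (fun z C => 1 * corrector j z C) = corrector j); last first.
  by apply/funext => z; apply/funext => C; rewrite mul1r.
have := ler_wpM2l eta0 v1.
rewrite state_expN ler_norml; lra.
Qed.

(** [below] and [corrector] differ by the product of [hit_sum] and the slope, and the
slope is at most 2. *)
Lemma below_exp t j x B : (0 < j)%N -> reachable x B ->
  `|state_exp t (fun _ C => below j #|` C|) x B - corrector j x B| <=
  eta * (4 / (j%:R + 1)) + 2 * chain_exp t (fun z => \sum_(y <- A) `|hit y z|) x.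
Proof.
move=> j0 xB.
set u := fun z => \sum_(y <- A) `|hit y z|.
have h z C : reachable z C -> `|hit_sum z C * slope j (#|` C|)%fset| <= 2 * u z.
  move=> [_ _ CA]; rewrite normrM mulrC.
  have s2 : `|slope j (#|` C|)%fset| <= 2.
    apply: le_trans (slope_bound _ j0) _.
    have j1 : 1 <= j%:R :> R by rewrite ler1n.
    by rewrite ler_pdivrMr; lra.
  apply: ler_pM => //; apply: le_trans (ler_norm_sum _ _ _) _.
  rewrite /u [leRHS](big_fsetID _ [in C]) /=.
  rewrite [X in X + _](_ : _ = \sum_(y <- C) `|hit y z|).
    by rewrite lerDl sumr_ge0.
  apply: eq_fbigl => y; rewrite !inE /=.
  by have [/(fsubsetP CA) ->|] := boolP (y \in C); rewrite ?andbF.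
have e z C : below j #|` C| = corrector j z C + hit_sum z C * slope j #|` C|.
  by rewrite /corrector subrK.
have c2 : state_exp t (fun z _ => 2 * u z) x B = 2 * chain_exp t u x.
  by rewrite state_exp_chain chain_expZ.
have up : state_exp t (fun _ C => below j #|` C|) x B <=
    state_exp t (corrector j) x B + 2 * chain_exp t u x.
  rewrite -c2 -state_expD; apply: state_exp_le => // z C zC.
  by rewrite (e z) lerD2l; apply: le_trans (ler_norm _) (h _ _ zC).
have lo : state_exp t (corrector j) x B <=
    state_exp t (fun _ C => below j #|` C|) x B + 2 * chain_exp t u x.
  rewrite -c2 -state_expD; apply: state_exp_le => // z C zC.
  rewrite (e z) -addrA lerDl; have := h _ _ zC; rewrite ler_norml; lra.
have := corrector_exp t j0 xB; rewrite !ler_norml; lra.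
Qed.

End UnvisitedSites.

(** * Real-valued probabilities and splitting along a discrete variable *)

Section RealProbability.
Variables (R : realType) (d : measure_display) (Omega : measurableType d).
Variable P : probability Omega R.
Implicit Types X Y : set Omega.

(** Real values let the additivity of P be used in ring computations. *)
Definition rpr X : R := fine (P X).

Lemma rprE X : measurable X -> P X = (rpr X)%:E.
Proof. by move=> mX; rewrite /rpr fineK // fin_num_measure. Qed.

Lemma rprU X Y : measurable X -> measurable Y -> X `&` Y = set0 ->
  rpr (X `|` Y) = rpr X + rpr Y.
Proof. by move=> mX mY XY; rewrite /rpr measureU // fineD ?fin_num_measure. Qed.

Lemma rpr_setID X Y : measurable X -> measurable Y ->
  rpr X = rpr (X `&` Y) + rpr (X `&` ~` Y).
Proof.
move=> mX mY; have mC : measurable (~` Y) by apply: measurableC.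
rewrite -rprU; [|exact: measurableI|exact: measurableI|].
  by rewrite -setIUr setUCr setIT.
by rewrite setIACA setICr setI0.
Qed.

Lemma rpr_ge0 X : 0 <= rpr X.
Proof. by rewrite fine_ge0. Qed.

Lemma rpr_le X Y : measurable X -> measurable Y -> X `<=` Y -> rpr X <= rpr Y.
Proof.
move=> mX mY XY; rewrite fine_le ?fin_num_measure //.
by apply: le_measure; rewrite ?inE.
Qed.

Lemma rprT : rpr setT = 1.
Proof. by rewrite /rpr probability_setT. Qed.

Lemma rprC X : measurable X -> rpr (~` X) = 1 - rpr X.
Proof.
move=> mX; have := rpr_setID measurableT mX.
by rewrite !setTI rprT => ->; rewrite addrAC subrr add0r.
Qed.

Lemma rpr_cvg_nd (F : nat -> set Omega) : (forall n, measurable (F n)) ->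
  (forall m n, (m <= n)%N -> F m `<=` F n) ->
  rpr (F n) @[n --> \oo] --> rpr (\bigcup_n F n).
Proof.
move=> mF ndF; have mU : measurable (\bigcup_n F n) by apply: bigcupT_measurable.
apply: fine_cvg; rewrite -rprE //.
apply: nondecreasing_cvg_mu => // m n mn.
by rewrite subsetEset; apply: ndF.
Qed.

Variable T : countType.
Variable f : Omega -> T.
Hypothesis mf : forall z, measurable (f @^-1` [set z]).

Lemma measurable_fibers (X : T -> set Omega) : (forall z, measurable (X z)) ->
  measurable [set w | X (f w) w].
Proof.
move=> mX.
rewrite (_ : [set w | _] = \bigcup_z ((f @^-1` [set z]) `&` X z)).
  by apply: countable_bigcupT_measurable => [|z]; [exact: countableP|exact: measurableI].
apply/seteqP; split => w /=; first by exists (f w).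
by move=> [z _ [/= -> ]].
Qed.

Lemma measurable_mem (s : pred T) : measurable [set w | s (f w)].
Proof.
apply: (@measurable_fibers (fun z => [set w | s z])) => z.
by case: (s z); rewrite ?set_true ?set_false.
Qed.

Lemma rpr_mem_seq X (s : seq T) : measurable X -> uniq s ->
  rpr (X `&` [set w | f w \in s]) = \sum_(z <- s) rpr (X `&` f @^-1` [set z]).
Proof.
move=> mX; elim: s => [|z s ih] /=.
  by rewrite big_nil (_ : X `&` _ = set0) ?/rpr ?measure0 //; apply/seteqP; split => w //= [].
move=> /andP[zs us]; rewrite big_cons -ih // -rprU.
- congr rpr; apply/seteqP; split => w /=.
    by rewrite inE => -[Xw /orP[/eqP|] h]; [left|right].
  by move=> [[Xw ->]|[Xw h]]; rewrite inE ?eqxx ?h ?orbT.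
- exact: measurableI.
- by apply: measurableI => //; apply: (measurable_mem (mem s)).
- apply/seteqP; split => w //= [[_ h] [_]]; rewrite h => h'.
  by rewrite h' in zs.
Qed.

(** The hypothesis says that on X the variable f takes its values in s almost surely. *)
Lemma rpr_split X Y (s : seq T) : measurable X -> measurable Y -> uniq s ->
  rpr X = \sum_(z <- s) rpr (X `&` f @^-1` [set z]) ->
  rpr (X `&` Y) = \sum_(z <- s) rpr (X `&` f @^-1` [set z] `&` Y).
Proof.
move=> mX mY us hX.
have mS : measurable [set w | f w \in s] by apply: (measurable_mem (mem s)).
have mXY : measurable (X `&` Y) by apply: measurableI.
rewrite (rpr_setID mXY mS) rpr_mem_seq //.
have -> : rpr (X `&` Y `&` ~` [set w | f w \in s]) = 0.
  apply/eqP; rewrite eq_le rpr_ge0 andbT.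
  have mXS : measurable (X `&` ~` [set w | f w \in s]).
    by apply: measurableI => //; apply: measurableC.
  have h := rpr_setID mX mS; rewrite rpr_mem_seq // -hX in h.
  have e : rpr (X `&` ~` [set w | f w \in s]) = 0.
    by apply: (addrI (rpr X)); rewrite -h addr0.
  rewrite -e; apply: rpr_le => //; last by move=> w [[]].
  by apply: measurableI => //; apply: measurableC.
by rewrite addr0; apply: eq_bigr => z _; congr rpr; rewrite setIAC.
Qed.

End RealProbability.

(** * The law of the number of sites that are never visited *)

Section ChainLaw.
Variables (R : realType) (d : measure_display) (Omega : measurableType d).
Variables (P : probability Omega R) (x0 : Z2) (S : nat -> Omega -> Z2).
Hypothesis hx0 : adj 0 x0.
Hypothesis hS : conditioned_walk P x0 S.
Variable A : {fset Z2}.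
Local Notation Q := (@cond_trans R).
Local Notation rpr := (rpr P).

Fixpoint unvisited (p : nat -> Z2) (m : nat) : {fset Z2} :=
  if m is m'.+1 then (unvisited p m' `\ p m)%fset else (A `\ p 0%N)%fset.

Lemma mem_unvisited p m y :
  (y \in unvisited p m) = (y \in A) && [forall i : 'I_m.+1, p i != y].
Proof.
elim: m => [|m ih] /=.
  rewrite !inE andbC eq_sym; congr (_ && _); apply/idP/forallP => [h i|/(_ ord0)] //.
  by rewrite (ord1 i).
rewrite !inE ih andbCA; congr (_ && _); rewrite eq_sym.
apply/andP/forallP => [[h1 /forallP h2] i|h].
  have := ltn_ord i; rewrite ltnS leq_eqVlt => /orP[/eqP -> //|im].
  exact: (h2 (Ordinal im)).
split; first exact: (h ord_max).
by apply/forallP => i; apply: (h (widen_ord (leqnSn _) i)).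
Qed.

Lemma eq_unvisited p p' m : (forall i, (i <= m)%N -> p i = p' i) ->
  unvisited p m = unvisited p' m.
Proof.
move=> h; apply/fsetP => y; rewrite !mem_unvisited; congr (_ && _).
by apply: eq_forallb => i; rewrite h // -ltnS.
Qed.

Lemma measurable_unvisited m (X : {fset Z2} -> Prop) :
  measurable [set w | X (unvisited (S ^~ w) m)].
Proof.
have [mS _ _ _] := hS.
elim: m X => [|m ih] X /=.
  apply: (@measurable_fibers _ _ _ (S 0) (mS 0%N) (fun z => [set w | X (A `\ z)%fset])) => z.
  have [h|h] := pselect (X (A `\ z)%fset).
    by rewrite (_ : [set w | _] = setT) //; apply/seteqP; split.
  by rewrite (_ : [set w | _] = set0) //; apply/seteqP; split.
apply: (@measurable_fibers _ _ _ (S m.+1) (mS m.+1)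
  (fun z => [set w | X (unvisited (S ^~ w) m `\ z)%fset])) => z.
exact: (ih (fun B => X (B `\ z)%fset)).
Qed.

Lemma measurable_path k p : measurable (path_event S k p).
Proof.
have [mS _ _ _] := hS.
elim: k => [|k ih].
  rewrite (_ : path_event _ _ _ = S 0 @^-1` [set p 0%N]) //.
  apply/seteqP; split => w /=; first exact.
  by move=> h i; rewrite leqn0 => /eqP ->.
rewrite (_ : path_event _ _ _ = path_event S k p `&` S k.+1 @^-1` [set p k.+1]).
  exact: measurableI.
apply/seteqP; split => w /=.
  by move=> h; split=> [i ik|]; apply: h => //; apply: leqW.
move=> [h1 h2] i; rewrite leq_eqVlt => /orP[/eqP -> //|].
exact: h1.
Qed.

Lemma rpr_path k p : rpr (path_event S k.+1 p) = rpr (path_event S k p) * Q (p k) (p k.+1).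
Proof.
have [_ _ _ h] := hS.
have := h k p; rewrite (rprE P (measurable_path k.+1 p)) (rprE P (measurable_path k p)).
by rewrite -EFinM => -[].
Qed.

Definition extend (p : nat -> Z2) k (z : Z2) i := if (i <= k)%N then p i else z.

Lemma path_extend p k z :
  path_event S k.+1 (extend p k z) = path_event S k p `&` S k.+1 @^-1` [set z].
Proof.
apply/seteqP; split => w /=.
  move=> h; split=> [i ik|]; first by rewrite (h i (leqW ik)) /extend ik.
  by rewrite (h k.+1 (leqnn _)) /extend ltnn.
move=> [h1 h2] i; rewrite /extend leq_eqVlt => /orP[/eqP ->|]; first by rewrite ltnn.
by rewrite ltnS => ik; rewrite ik h1.
Qed.

Lemma uniq_nbrs x : uniq (nbrs x).
Proof. by rewrite /nbrs /= !inE !xpair_eqE; lia. Qed.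

(** Induction on t, splitting along the position at time k+1. A path that ends at the
origin is an impossible event, and otherwise the transition probabilities to the
neighbours sum to 1, so no other position has positive probability. *)
Lemma rpr_path_state (X : pred {fset Z2}) t k p :
  rpr (path_event S k p `&` [set w | X (unvisited (S ^~ w) (k + t))]) =
  rpr (path_event S k p) * state_exp t (fun _ B => (X B)%:R) (p k) (unvisited p k).
Proof.
have [mS hE _ _] := hS.
elim: t k p => [|t ih] k p.
  rewrite addn0 /=.
  have e w : path_event S k p w -> unvisited (S ^~ w) k = unvisited p k.
    by move=> h; apply: eq_unvisited => i ik; rewrite h.
  have [h|h] := boolP (X (unvisited p k)).
    rewrite mulr1; congr rpr; apply/seteqP; split => w /=; first by case.
    by move=> hw; rewrite e.
  rewrite mulr0 (_ : _ `&` _ = set0) ?/rpr ?measure0 //.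
  by apply/seteqP; split => w //= [hw]; rewrite e // (negbTE h).
have mp := measurable_path k p.
have [pk0|pk0] := eqVneq (p k) 0.
  have -> : path_event S k p = set0.
    apply/seteqP; split => w //= h; have := hE k w => /=.
    by rewrite h // pk0 eqxx.
  by rewrite set0I /rpr measure0 mul0r.
have fib z : rpr (path_event S k p `&` S k.+1 @^-1` [set z]) =
    rpr (path_event S k p) * Q (p k) z.
  rewrite -path_extend rpr_path {2 3}/extend leqnn ltnn; congr (rpr _ * _).
  by apply/seteqP; split => w h i ik; rewrite h // /extend ik.
have mY := measurable_unvisited (k + t.+1) X.
rewrite (rpr_split (mS k.+1) mp mY (uniq_nbrs (p k))); last first.
  under eq_bigr do rewrite fib.
  by rewrite -mulr_sumr cond_trans_sum1 // mulr1.
rewrite /= mulr_sumr; apply: eq_bigr => z _.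
rewrite -path_extend addnS -addSn ih path_extend fib -mulrA.
congr (_ * (_ * _)).
have -> : extend p k z k.+1 = z by rewrite /extend ltnn.
congr state_exp => /=; rewrite {2}/extend ltnn; congr (_ `\ _)%fset.
by apply: eq_unvisited => i ik; rewrite /extend ik.
Qed.

Lemma rpr_unvisited (X : pred {fset Z2}) t :
  rpr [set w | X (unvisited (S ^~ w) t)] =
  state_exp t (fun _ B => (X B)%:R) x0 (A `\ x0)%fset.
Proof.
have [mS _ h0 _] := hS.
have := @rpr_path_state X t 0 (fun=> x0); rewrite add0n /=.
have -> : path_event S 0 (fun=> x0) = S 0 @^-1` [set x0].
  apply/seteqP; split => w /=; first exact.
  by move=> h i; rewrite leqn0 => /eqP ->.
have e1 : rpr (S 0 @^-1` [set x0]) = 1 by rewrite /rpr h0.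
rewrite e1 mul1r => <-.
have mX := measurable_unvisited t X.
rewrite (rpr_setID P mX (mS 0%N x0)) setIC.
suff -> : rpr ([set w | X (unvisited (S ^~ w) t)] `&` ~` (S 0 @^-1` [set x0])) = 0.
  by rewrite addr0.
apply/eqP; rewrite eq_le rpr_ge0 andbT.
have mC : measurable (~` (S 0 @^-1` [set x0])) by apply: measurableC.
have e0 : rpr (~` (S 0 @^-1` [set x0])) = 0 by rewrite rprC // e1 subrr.
by rewrite -e0; apply: rpr_le (measurableI _ _ mX mC) mC _ => w [].
Qed.

Definition never_visited (w : Omega) : {fset Z2} :=
  [fset y in A | y \notin walk_range S w]%fset.

(** All sites of the finite set A that are ever visited have been visited by some finite
time. *)
Lemma card_never_visited_lt j :
  [set w | (#|` never_visited w| < j)%N] =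
  \bigcup_t [set w | (#|` unvisited (S ^~ w) t| < j)%N].
Proof.
have sub w t : (never_visited w `<=` unvisited (S ^~ w) t)%fset.
  apply/fsubsetP => y; rewrite !inE /= => /andP[yA yw]; rewrite mem_unvisited yA /=.
  apply/forallP => i; apply: contraNneq yw => e; rewrite in_setE.
  by exists i.
apply/seteqP; split => w /=; last first.
  by move=> [t _]; apply: leq_ltn_trans; apply: fsubset_leq_card.
move=> hj; suff [t ht] : exists t, (unvisited (S ^~ w) t `<=` never_visited w)%fset.
  by exists t => //=; apply: leq_ltn_trans hj; apply: fsubset_leq_card.
have : forall s : seq Z2, exists t, forall y, y \in s -> y \in walk_range S w ->
    exists2 i, (i <= t)%N & S i w = y.
  elim=> [|y s [t ht]]; first by exists 0%N.
  have [[m hm]|hy] := pselect (exists m, S m w = y).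
    exists (maxn t m) => y'; rewrite inE => /orP[/eqP ->|ys] yw.
      by exists m => //; rewrite leq_maxr.
    have [i it e] := ht _ ys yw; exists i => //.
    by rewrite (leq_trans it) // leq_maxl.
  exists t => y'; rewrite inE => /orP[/eqP ->|ys] yw; last exact: ht.
  by move: yw; rewrite in_setE => -[m hm]; case: hy; exists m.
move=> /(_ (enum_fset A)) [t ht]; exists t; apply/fsubsetP => y.
rewrite mem_unvisited !inE /= => /andP[yA /forallP h]; rewrite yA /=.
apply/negP => yw; have [i it e] := ht y yA yw.
have := h (Ordinal (it : (i < t.+1)%N)); by rewrite /= e eqxx.
Qed.

Lemma measurable_never_visited j : measurable [set w | (#|` never_visited w| < j)%N].
Proof.
rewrite card_never_visited_lt; apply: bigcupT_measurable => t.
exact: (measurable_unvisited t (fun B => (#|` B| < j)%N)).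
Qed.

Lemma unvisited_sub p m n : (m <= n)%N -> (unvisited p n `<=` unvisited p m)%fset.
Proof.
move=> /subnK <-; elim: (n - m)%N => [|l ih] //.
by rewrite addSn /=; apply: fsubset_trans ih; apply: fsubD1set.
Qed.

Lemma nbr0_neq0 : x0 != 0.
Proof. by apply: contraTneq hx0 => ->. Qed.

(** The limit of [below_exp] as t tends to infinity: its left side converges by
monotonicity of the events, and its last term vanishes by transience. *)
Lemma never_visited_law (eta : R) j : 0 \notin A -> 0 <= eta ->
  (forall z (B : {fset Z2}), z \in A -> (B `<=` A `\ z)%fset ->
     `|hit_sum R z B - #|` B|%:R / 2| <= eta) ->
  (0 < j)%N ->
  `|rpr [set w | (#|` never_visited w| < j)%N] - corrector R j x0 (A `\ x0)%fset|
    <= eta * (4 / (j%:R + 1)).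
Proof.
move=> A0 eta0 hh j0; have x00 := nbr0_neq0.
have rx : reachable A x0 (A `\ x0)%fset by split=> //; rewrite ?inE ?eqxx // fsubD1set.
pose F t := [set w | (#|` unvisited (S ^~ w) t| < j)%N].
have cF : rpr (F t) @[t --> \oo] --> rpr [set w | (#|` never_visited w| < j)%N].
  rewrite card_never_visited_lt; apply: rpr_cvg_nd.
    by move=> t; apply: (measurable_unvisited t (fun B => (#|` B| < j)%N)).
  move=> m n mn w /= h; apply: leq_ltn_trans h.
  by apply: fsubset_leq_card; apply: unvisited_sub.
pose u t := chain_exp t (fun z => \sum_(y <- A) `|hit R y z|) x0.
have cu : u @ \oo --> (0 : R).
  rewrite (_ : u = fun t => \sum_(y <- A) chain_exp t (fun z => `|hit R y z|) x0); last first.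
    by apply/funext => t; rewrite /u chain_exp_sum.
  apply: cvg_sum0 => y yA; apply: hit_vanishes => //.
  by apply: contraNneq A0 => <-.
have bF t : `|rpr (F t) - corrector R j x0 (A `\ x0)%fset| <=
    eta * (4 / (j%:R + 1)) + 2 * u t.
  rewrite (@rpr_unvisited (fun B => (#|` B| < j)%N) t).
  exact: below_exp.
set c := corrector _ _ _ _ in bF *; set b := eta * _ in bF *.
set r := rpr _ in cF *.
apply/ler_addgt0Pr => e e0.
have e3 : 0 < e / 3 by lra.
move/cvgrPdist_le : cF => /(_ _ e3) [N1 _ h1].
move/cvgr0Pnorm_le : cu => /(_ _ e3) [N2 _ h2].
have := h1 (maxn N1 N2) (leq_maxl _ _); have := h2 (maxn N1 N2) (leq_maxr _ _).
have := bF (maxn N1 N2).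
rewrite /= !ler_norml; lra.
Qed.

End ChainLaw.

(** * Logarithmic scales *)

Section LogarithmicScale.
Variable R : realType.
Local Notation a := (@potential_kernel R).
Local Notation nrm := (enorm R).

(** The sixth power of exp(-1/6) >= 5/6 exceeds 1/3. *)
Lemma ln3_gt1 : 1 < ln 3 :> R.
Proof.
rewrite -[ltLHS]expRK ltr_ln ?posrE ?expR_gt0 //.
have h : (5 / 6) ^+ 6 <= expR (- 1) :> R.
  rewrite (_ : - 1 = 6%:R * - (1 / 6)); last by field.
  rewrite expRM_natl lerXn2r ?nnegrE ?expR_ge0 //.
  by apply: le_trans (expR_ge1Dx _); lra.
have : expR 1 * expR (- 1) = 1 :> R by rewrite -expRD subrr expR0.
have := expR_gt0 (1 : R); nra.
Qed.

Lemma ln_nat_gt1 n : (3 <= n)%N -> 1 < ln n%:R :> R.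
Proof.
move=> n3; apply: lt_le_trans ln3_gt1 _.
by rewrite ler_ln ?posrE ?ltr0n ?ler_nat //; lia.
Qed.

Lemma ln_le_sub1 (u : R) : 0 < u -> ln u <= u - 1.
Proof.
move=> u0; rewrite -[in leLHS](_ : 1 + (u - 1) = u); last by ring.
by apply: le_ln1Dx; lra.
Qed.

(** The least value of ln ln n for n >= 3; bounded error terms are absorbed into
multiples of ln ln n through it. *)
Definition lnln3 : R := ln (ln 3).

Lemma lnln3_gt0 : 0 < lnln3.
Proof. by rewrite ln_gt0 // ln3_gt1. Qed.

Lemma lnln_ge n : (3 <= n)%N -> lnln3 <= ln (ln n%:R) :> R.
Proof.
move=> n3; have l3 := ln3_gt1; have ln := ln_nat_gt1 n3.
rewrite ler_ln ?posrE; [|lra..].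
by rewrite ler_ln ?posrE ?ltr0n ?ler_nat //; lia.
Qed.

(** Concavity gives M0 ln L <= L/2 + M0 ln(2 M0), so a(y) is at least L/4 minus a
constant; the constant is absorbed by a >= 3/4. For small n the annulus may reach the
neighbourhood of the origin, where only the latter bound is useful. *)
Lemma potential_annulus_lb (M0 : R) : 0 < M0 -> exists kappa : R, 0 < kappa /\
  forall n (y : Z2), (3 <= n)%N -> y != 0 ->
    ln n%:R - M0 * ln (ln n%:R) <= ln (nrm y) -> kappa * ln n%:R <= a y.
Proof.
move=> hM0; pose K := 729 + `|M0 * ln (2 * M0) / 2|.
have K0 : 0 < K by have := normr_ge0 (M0 * ln (2 * M0) / 2); rewrite /K; lra.
have k0 : 0 < 4 * (1 + 4 / 3 * K) by lra.
exists (4 * (1 + 4 / 3 * K))^-1; split; first by rewrite invr_gt0.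
move=> n y n3 y0 hy; have L1 := ln_nat_gt1 n3; set L := ln n%:R in L1 hy *.
have hL : M0 * ln L <= L / 2 + M0 * ln (2 * M0).
  have e : ln L <= L / (2 * M0) + ln (2 * M0).
    have p : 0 < L / (2 * M0) by rewrite divr_gt0 ?mulr_gt0 //; lra.
    have e1 : ln L = ln (L / (2 * M0)) + ln (2 * M0).
      have p2 : 0 < 2 * M0 by rewrite mulr_gt0.
      by rewrite -lnM ?posrE // divfK // gt_eqF.
    rewrite e1 lerD2r.
    apply: le_trans (_ : L / (2 * M0) - 1 <= _); last by lra.
    exact: ln_le_sub1.
  apply: le_trans (ler_wpM2l (ltW hM0) e) _.
  by rewrite mulrDr le_eqVlt; apply/orP; left; apply/eqP; field; rewrite gt_eqF.
have h1 := potential_ln_lb R y0; have h2 := potential_lb R y0.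
have h3 : M0 * ln (2 * M0) / 2 <= `|M0 * ln (2 * M0) / 2| by apply: ler_norm.
rewrite ler_pdivrMl //.
have h4 : L / 4 <= a y + K.
  rewrite /K; set m1 := M0 * ln L in hy hL; set m2 := M0 * ln (2 * M0) in hL h3 *; lra.
nra.
Qed.

Lemma potential_ub (y : Z2) : y != 0 -> a y <= 1505 * nrm y.
Proof.
move=> y0; have e0 : ((1, 0) : Z2) != 0 by [].
have := potential_harmonic R 0; rewrite eqxx potential0 add0r sum_nbrs /=.
have := potential_ge0 R (0 - 1, 0); have := potential_ge0 R (0, 0 + 1).
have := potential_ge0 R (0, 0 - 1); have := potential_log_diff R y0 e0.
rewrite [ln (nrm (1, 0))](_ : _ = 0); last first.
  by rewrite /enorm /= expr0n addr0 expr1n sqrtr1 ln1.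
have ny := enorm_ge1 R y0.
have : ln (nrm y) <= nrm y - 1.
  by apply: ln_le_sub1; lra.
have l0 : 0 <= ln (nrm y) by rewrite ln_ge0.
rewrite subr0 (ger0_norm l0) ler_norml add0r mulr1n; lra.
Qed.

End LogarithmicScale.

(** * Hitting functions inside the annulus *)

Section Annulus.
Variables (R : realType) (M0 : R).
Hypothesis hM0 : 0 < M0.
Local Notation a := (@potential_kernel R).
Local Notation nrm := (enorm R).
Local Notation hit := (@hit R).
Local Notation hit_sum := (@hit_sum R).

Definition log_ratio (n : nat) : R := ln (ln n%:R) / ln n%:R.

Definition in_annulus (n : nat) (A : {fset Z2}) : Prop :=
  {in A, forall x, x \in eball 0 (n%:R : R) /\ x \notin eball 0 (inner_radius M0 n)}.

Lemma natr3_gt0 n : (3 <= n)%N -> 0 < n%:R :> R.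
Proof. by move=> n3; rewrite ltr0n (leq_trans _ n3). Qed.

Lemma ln_inner_radius n : (3 <= n)%N ->
  0 < inner_radius M0 n /\ ln (inner_radius M0 n) = ln n%:R - M0 * ln (ln n%:R).
Proof.
move=> n3; have L1 := ln_nat_gt1 R n3.
have np := natr3_gt0 n3.
have pp : 0 < ln n%:R `^ M0 by rewrite powR_gt0; lra.
by rewrite /inner_radius divr_gt0 // ln_div ?posrE // ln_powR.
Qed.

Lemma annulusP n A x : (3 <= n)%N -> in_annulus n A -> x \in A ->
  [/\ x != 0, nrm x <= n%:R, inner_radius M0 n < nrm x,
    ln n%:R - M0 * ln (ln n%:R) <= ln (nrm x) & ln (nrm x) <= ln n%:R].
Proof.
move=> n3 hA xA; have [] := hA x xA; rewrite !inE subr0 -ltNge => h1 h2.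
have [r0 hr] := ln_inner_radius n3.
have np := natr3_gt0 n3.
have xp : 0 < nrm x by apply: lt_trans h2.
split=> //.
- by apply: contraTneq xp => ->; rewrite enorm0 ltxx.
- by rewrite -hr ler_ln ?posrE // ltW.
- by rewrite ler_ln ?posrE.
Qed.

Lemma hit_sub_half y z : a z != 0 -> hit y z - 1 / 2 = (a y - a (z - y)) / (2 * a z).
Proof. by move=> az; rewrite /hit; field. Qed.

Lemma hit_sum_half z (B : {fset Z2}) :
  hit_sum z B - #|` B|%:R / 2 = \sum_(y <- B) (hit y z - 1 / 2).
Proof.
rewrite sumrB /hit_sum; congr (_ - _).
rewrite big_const_seq count_predT iter_addr_0 -[RHS]mulr_natl div1r.
by [].
Qed.

Lemma card_eball_le n (A : {fset Z2}) z : z \in A ->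
  #|` [fset y in A | y \in eball z (inner_radius M0 n)]%fset|%:R <=
  #|` A|%:R * max_local_frac M0 n A.
Proof.
move=> zA; rewrite /max_local_frac mulrA mulfV ?mul1r; last first.
  by rewrite pnatr_eq0 cardfs_eq0; apply: contraTneq zA => ->; rewrite inE.
rewrite ler_nat.
exact: (@leq_bigmax_seq _ _ xpredT
  (fun y => #|` [fset z in A | z \in eball y (inner_radius M0 n)]%fset|) z).
Qed.

Lemma inv_card_le_max_local_frac n (A : {fset Z2}) : (3 <= n)%N -> A != fset0 ->
  #|` A|%:R^-1 <= max_local_frac M0 n A.
Proof.
move=> n3 A0; have Np : 0 < #|` A|%:R :> R by rewrite ltr0n cardfs_gt0.
have [z zA] : exists z, z \in A by apply/fset0Pn.
rewrite -(ler_pM2l Np) divff ?gt_eqF //; apply: le_trans (card_eball_le n zA).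
rewrite ler1n cardfs_gt0; apply/fset0Pn; exists z; rewrite !inE zA /= subrr enorm0.
by have [/ltW] := ln_inner_radius n3.
Qed.

(** The deviation of [hit y z] from 1/2 is (a(y) - a(z-y))/(2 a(z)), with a(z) of order
ln n. If y is outside the ball of inner radius around z, then |y| and |z-y| agree up to
a power of ln n and the numerator is O(ln ln n). The remaining y form at most the
fraction [max_local_frac] of A, and there the numerator is O(ln n). *)
Lemma annulus_hit_half : exists K : R, 0 < K /\
  forall n (A : {fset Z2}), (3 <= n)%N -> in_annulus n A ->
  forall z (B : {fset Z2}), z \in A -> (B `<=` A `\ z)%fset ->
  `|hit_sum z B - #|` B|%:R / 2| <=
    #|` A|%:R * (K * (log_ratio n + max_local_frac M0 n A)).
Proof.
have [kappa [kp hk]] := potential_annulus_lb hM0.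
have c0 := lnln3_gt0 R.
have [C C0 hC] : exists2 C : R, 0 < C & forall x y : Z2, x != 0 -> y != 0 ->
    `|a x - a y| <= C + `|ln (nrm x) - ln (nrm y)|.
  by exists 1500; [rewrite ltr0n | exact: potential_log_diff].
have [C1 C10 hC1] : exists2 C1 : R, 0 < C1 &
    forall L, lnln3 R <= ln L -> C + 1 + M0 * ln L <= C1 * ln L.
  have p : 0 < (C + 1) / lnln3 R by rewrite divr_gt0; lra.
  exists ((C + 1) / lnln3 R + M0) => [|L hL]; first by move: (hM0); lra.
  by rewrite mulrDl lerD2r mulrAC ler_pdivlMr // ler_pM2l //; lra.
have [C2 C20 hC2] : exists2 C2 : R, 0 < C2 & forall L, 1 < L -> C + 1 + L <= C2 * L.
  by exists (C + 2) => [|L hL]; [lra | nra].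
exists ((C1 + C2) / (2 * kappa)); split; first by rewrite divr_gt0; lra.
move=> n A n3 hA z B zA BA.
have L1 := ln_nat_gt1 R n3; have LL := lnln_ge R n3.
have [z0 zn zr zl zu] := annulusP n3 hA zA.
set q := log_ratio n; set r := inner_radius M0 n.
set L := ln n%:R in L1 LL zl zu *.
have az : kappa * L <= a z by apply: hk.
have kL : 0 < kappa * L by rewrite mulr_gt0 //; lra.
have azp : 0 < a z by lra.
have v0 : 0 <= (2 * a z)^-1 by rewrite invr_ge0; lra.
have hv : (2 * a z)^-1 <= (2 * (kappa * L))^-1 by rewrite lef_pV2 ?posrE; lra.
have far y : y \in A -> y \notin eball z r -> `|hit y z - 1 / 2| <= C1 / (2 * kappa) * q.
  move=> yA; rewrite inE -ltNge => hy.
  have [y0 yn yr yl yu] := annulusP n3 hA yA; rewrite -/L in yl yu.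
  have [r0 hr] := ln_inner_radius n3.
  have dp : 0 < nrm (z - y) by rewrite -enormN opprB; apply: lt_trans hy.
  have dl : L - M0 * ln L <= ln (nrm (z - y)).
    by rewrite -hr -enormN opprB ler_ln ?posrE 1?ltW // -enormN opprB.
  have du : ln (nrm (z - y)) <= L + ln 2.
    have np := natr3_gt0 n3.
    rewrite -lnM ?posrE // ler_ln ?posrE ?mulr_gt0 //.
    have := enorm_triangle R z (- y); rewrite enormN; lra.
  have d0 : z - y != 0 by apply: contraTneq dp => ->; rewrite enorm0 ltxx.
  rewrite hit_sub_half ?gt_eqF // normrM [X in _ * X]gtr0_norm ?invr_gt0 ?mulr_gt0 //.
  have h : `|a y - a (z - y)| <= C1 * ln L.
    apply: le_trans (hC _ _ y0 d0) _.
    have l2 := ln2_le1 R.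
    have : `|ln (nrm y) - ln (nrm (z - y))| <= M0 * ln L + 1.
      rewrite ler_norml; lra.
    by have := hC1 _ LL; lra.
  apply: le_trans (ler_pM (normr_ge0 _) v0 h hv) _.
  rewrite /q /log_ratio -/L le_eqVlt; apply/orP; left; apply/eqP; field.
  by rewrite !gt_eqF //; lra.
have near y : y \in A -> y != z -> `|hit y z - 1 / 2| <= C2 / (2 * kappa).
  move=> yA yz; have [y0 yn yr yl yu] := annulusP n3 hA yA; rewrite -/L in yl yu.
  have d0 : z - y != 0 by rewrite subr_eq0 eq_sym.
  have d1 := enorm_ge1 R d0; have y1 := enorm_ge1 R y0.
  have du : ln (nrm (z - y)) <= L + ln 2.
    have np := natr3_gt0 n3.
    rewrite -lnM ?posrE // ler_ln ?posrE ?mulr_gt0 //; last by lra.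
    have := enorm_triangle R z (- y); rewrite enormN; lra.
  rewrite hit_sub_half ?gt_eqF // normrM [X in _ * X]gtr0_norm ?invr_gt0 ?mulr_gt0 //.
  have h : `|a y - a (z - y)| <= C2 * L.
    apply: le_trans (hC _ _ y0 d0) _.
    have l2 := ln2_le1 R.
    have ld := ln_ge0 d1; have ly := ln_ge0 y1.
    have : `|ln (nrm y) - ln (nrm (z - y))| <= L + 1 by rewrite ler_norml; lra.
    by have := hC2 _ L1; lra.
  apply: le_trans (ler_pM (normr_ge0 _) v0 h hv) _.
  rewrite le_eqVlt; apply/orP; left; apply/eqP; field.
  by rewrite !gt_eqF //; lra.
have q0 : 0 <= q by rewrite /q /log_ratio -/L divr_ge0; lra.
have Cq0 : 0 <= C1 / (2 * kappa) * q by rewrite mulr_ge0 // divr_ge0; lra.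
have Ck0 : 0 <= C2 / (2 * kappa) by rewrite divr_ge0; lra.
rewrite hit_sum_half; apply: le_trans (ler_norm_sum _ _ _) _.
apply: (@le_trans _ _ (\sum_(y <- A) (C1 / (2 * kappa) * q +
    C2 / (2 * kappa) * (y \in eball z r)%:R))).
  have sub : (B `<=` A)%fset by apply: fsubset_trans BA (fsubD1set _ _).
  rewrite [leRHS](big_fsetID _ [in B]) /=.
  rewrite [X in X + _](_ : _ = \sum_(y <- B) (C1 / (2 * kappa) * q +
    C2 / (2 * kappa) * (y \in eball z r)%:R)); last first.
    apply: eq_fbigl => y; rewrite !inE /=.
    by have [/(fsubsetP sub) ->|] := boolP (y \in B); rewrite ?andbF.
  rewrite -[leLHS]addr0; apply: lerD; last first.
    by apply: sumr_ge0 => y _; rewrite addr_ge0 // mulr_ge0.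
  rewrite !big_seq; apply: ler_sum => y yB.
  have yA := fsubsetP sub _ yB.
  have yz : y != z by have := fsubsetP BA _ yB; rewrite !inE => /andP[].
  have [hin|hout] := boolP (y \in eball z r).
    by apply: le_trans (near _ yA yz) _; rewrite mulr1 lerDr.
  by rewrite mulr0 addr0 far.
rewrite big_split /= -[X in _ + X <= _]mulr_sumr.
have -> : \sum_(y <- A) (C1 / (2 * kappa) * q) = #|` A|%:R * (C1 / (2 * kappa) * q).
  by rewrite big_const_seq count_predT iter_addr_0 -[LHS]mulr_natl.
have hc : \sum_(y <- A) (y \in eball z r)%:R <= #|` A|%:R * max_local_frac M0 n A.
  apply: le_trans (card_eball_le n zA).
  rewrite -/r -natr_sum ler_nat card_fset_sum1 -big_fset_condE.
  by rewrite [X in (_ <= X)%N]big_mkcond; apply: leq_sum => y _; case: (y \in _).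
set N : R := #|` A|%:R in hc *; set ell := max_local_frac M0 n A in hc *.
have N0 : 0 <= N by rewrite /N.
have ell0 : 0 <= N * ell by apply: le_trans hc; apply: sumr_ge0.
have := ler_wpM2l Ck0 hc.
have e1 : 0 <= C1 / (2 * kappa) * (N * ell) by rewrite mulr_ge0 // divr_ge0; lra.
have e2 : 0 <= C2 / (2 * kappa) * (N * q) by rewrite mulr_ge0 // mulr_ge0.
rewrite [(C1 + _) / _]mulrDl; lra.
Qed.

(** Here the denominator 2 a(x0) is bounded, so the comparison of logarithms would give
only O(1). The gradient bound gives O(1/|y|) instead, and |y| is at least a multiple of
a(y), hence of ln n. *)
Lemma annulus_start_half : exists K : R, 0 < K /\
  forall n (A : {fset Z2}) x0, (3 <= n)%N -> in_annulus n A -> adj 0 x0 ->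
  `|hit_sum x0 (A `\ x0)%fset - #|` A `\ x0|%fset%:R / 2| <=
    #|` A `\ x0|%fset%:R * (K * log_ratio n).
Proof.
have [kappa [kp hk]] := potential_annulus_lb hM0.
have c0 := lnln3_gt0 R.
have [C1 C10 hC1] : exists2 C : R, 0 < C & forall x z : Z2, x != 0 ->
    z \in nbrs x -> `|a x - a z| <= C / nrm x.
  by exists 720; [rewrite ltr0n | exact: potential_grad].
have [C2 C20 hC2] : exists2 C : R, 0 < C & forall y : Z2, y != 0 -> a y <= C * nrm y.
  by exists 1505; [rewrite ltr0n | exact: potential_ub].
have C120 : 0 < C1 * C2 by rewrite mulr_gt0.
exists (C1 * C2 / (kappa * lnln3 R)); split; first by rewrite divr_gt0 ?(mulr_gt0 kp).
move=> n A x0 n3 hA hx0.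
have L1 := ln_nat_gt1 R n3; have LL := lnln_ge R n3.
set L := ln n%:R in L1 LL *.
have x00 : x0 != 0 by apply: contraTneq hx0 => ->.
have ax := potential_lb R x00.
rewrite hit_sum_half; apply: le_trans (ler_norm_sum _ _ _) _.
have -> (c : R) : #|` A `\ x0|%fset%:R * c = \sum_(y <- (A `\ x0)%fset) c.
  by rewrite big_const_seq count_predT iter_addr_0 -[RHS]mulr_natl.
rewrite !big_seq; apply: ler_sum => y; rewrite !inE => /andP[yx yA].
have [y0 yn yr yl yu] := annulusP n3 hA yA; rewrite -/L in yl yu.
have az : kappa * L <= a y by apply: hk.
have y1 := enorm_ge1 R y0.
have kL : 0 < kappa * L by rewrite mulr_gt0 //; lra.
rewrite hit_sub_half; last by rewrite gt_eqF //; lra.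
have yn0 : (y - x0) \in nbrs y.
  by move: hx0; rewrite /adj /nbrs !inE; case: x0 {x00 ax yx} => u v;
    case: y {yA y0 yn yr yl yu az y1} => u' v'; rewrite !xpair_eqE /=; lia.
have g := hC1 _ _ y0 yn0.
rewrite -(potentialN R (x0 - y)) opprB normrM [X in _ * X]gtr0_norm; last first.
  by rewrite invr_gt0; lra.
have h1 : (2 * a x0)^-1 <= 1 by rewrite invf_le1; lra.
have v0 : 0 <= (2 * a x0)^-1 by rewrite invr_ge0; lra.
have yp : 0 < nrm y by lra.
have h2 : (nrm y)^-1 <= C2 / (kappa * L).
  rewrite ler_pdivlMr // mulrC ler_pdivrMr //.
  exact: le_trans az (hC2 _ y0).
apply: le_trans (ler_pM (normr_ge0 _) v0 g h1) _.
rewrite mulr1; apply: le_trans (ler_wpM2l (ltW C10) h2) _.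
rewrite /log_ratio -/L [leLHS]mulrA.
have Lp : 0 < L by lra.
rewrite [leRHS](_ : _ = C1 * C2 / (kappa * L) * (ln L / lnln3 R)); last first.
  by field; rewrite !gt_eqF.
have p : 0 < C1 * C2 / (kappa * L) by rewrite divr_gt0.
by rewrite -[leLHS]mulr1 ler_pM2l // ler_pdivlMr // mul1r.
Qed.

End Annulus.

(** * The distribution function *)

(** The corrector at time 0 is close to j/(k+1), where k is |A| or |A| - 1 according to
whether the starting point lies in A. *)
Lemma never_visited_annulus_law (R : realType) (M0 : R) : 0 < M0 ->
  exists c : R, 0 < c /\
  forall (d : measure_display) (Omega : measurableType d)
    (P : probability Omega R) (x0 : Z2) (S : nat -> Omega -> Z2),
    adj 0 x0 -> conditioned_walk P x0 S ->
  forall (n : nat) (A : {fset Z2}), (3 <= n)%N -> A != fset0 -> in_annulus M0 n A ->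
  forall j : nat, (0 < j)%N -> (j <= #|` A|.+1)%N ->
    `|rpr P [set w | (#|` never_visited S A w| < j)%N] - j%:R / #|` A|%:R| <=
    c * (log_ratio R n + max_local_frac M0 n A) * (1 + #|` A|%:R / j%:R).
Proof.
move=> hM0; have [K1 [K10 h1]] := annulus_hit_half hM0.
have [K2 [K20 h2]] := annulus_start_half hM0.
exists (4 * K1 + 2 * K2 + 2); split; first by lra.
move=> d Omega P x0 S hx0 hS n A n3 A0 hA j j0 jA.
set N : R := #|` A|%:R; set q := log_ratio R n; set ell := max_local_frac M0 n A.
have L1 := ln_nat_gt1 R n3; have LL := lnln_ge R n3; have c0 := lnln3_gt0 R.
have q0 : 0 <= q by rewrite /q /log_ratio divr_ge0; lra.
have cA : (0 < #|` A|)%N by rewrite cardfs_gt0.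
have Np : 0 < N by rewrite ltr0n.
have N1 : 1 <= N by rewrite ler1n.
have N0 : N != 0 by rewrite gt_eqF.
have ellN : N^-1 <= ell := inv_card_le_max_local_frac M0 n3 A0.
have Np' : 0 < N^-1 by rewrite invr_gt0.
have jp : 0 < j%:R :> R by rewrite ltr0n.
have j1 : 1 <= j%:R :> R by rewrite ler1n.
have jN : j%:R <= N + 1 by rewrite /N natr1 ler_nat.
have A00 : 0 \notin A.
  by apply/negP => zA; have [] := annulusP n3 hA zA; rewrite eqxx.
have eta0 : 0 <= N * (K1 * (q + ell)).
  by rewrite mulr_ge0 ?mulr_ge0 //; lra.
have law := never_visited_law hx0 hS A00 eta0 (h1 _ _ n3 hA) j0.
have start := h2 _ _ _ n3 hA hx0; rewrite -/q in start.
set c := corrector _ _ _ _ in law.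
clear h1 h2 hA hS hx0 A00 eta0 hM0 LL L1 c0.
have hc : `|c - j%:R / N| <= 2 * K2 * q + 2 * ell.
  rewrite /c {c law}; set B := (A `\ x0)%fset in start *; set k := #|` B| in start *.
  have hk : k = #|` A| \/ k.+1 = #|` A|.
    by have := cardfsD1 x0 A; rewrite -/B -/k; case: (x0 \in A) => ->; [right|left].
  have hkN : N - 1 <= k%:R <= N.
    case: hk => e; rewrite /N -e; last rewrite -natr1; lra.
  have k0 : 0 <= k%:R :> R by [].
  rewrite /corrector -/k /below /slope.
  have [kj|jk] := ltnP k j.
    rewrite mulr0 subr0 mulr1n.
    have kj' : k%:R + 1 <= j%:R :> R by rewrite natr1 ler_nat.
    have : `|1 - j%:R / N| <= N^-1.
      rewrite -{1}(divff N0) -mulrBl normrM [X in _ * X]gtr0_norm //.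
      by rewrite ler_piMl ?ler_norml; lra.
    have : 0 <= 2 * K2 * q by rewrite mulr_ge0 // mulr_ge0 // ltW.
    lra.
  have jk' : j%:R <= k%:R :> R by rewrite ler_nat.
  set h := hit_sum R x0 B in start *.
  have kp : 0 < k%:R :> R by lra.
  have e : 0 - h * - (2 * j%:R / (k%:R * (k%:R + 1))) - j%:R / N =
     (h - k%:R / 2) * (2 * j%:R / (k%:R * (k%:R + 1))) + (j%:R / (k%:R + 1) - j%:R / N).
    by field; rewrite !gt_eqF //; lra.
  rewrite mulr0n e; apply: le_trans (ler_normD _ _) _; apply: lerD.
    rewrite normrM.
    have p : 0 <= 2 * j%:R / (k%:R * (k%:R + 1)) :> R.
      by rewrite divr_ge0 // ?mulr_ge0 //; lra.
    rewrite (ger0_norm p); apply: le_trans (ler_wpM2r p start) _.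
    rewrite [leLHS](_ : _ = 2 * K2 * q * (j%:R / (k%:R + 1))); last first.
      by field; rewrite !gt_eqF //; lra.
    have hj : j%:R / (k%:R + 1) <= 1 :> R by rewrite ler_pdivrMr; lra.
    by rewrite ler_piMr // mulr_ge0 // mulr_ge0 // ltW.
  rewrite (_ : _ - _ = j%:R / (k%:R + 1) * ((N - (k%:R + 1)) / N)); last first.
    by field; rewrite !gt_eqF //; lra.
  have hj0 : 0 <= j%:R / (k%:R + 1) :> R by rewrite divr_ge0; lra.
  have hj1 : j%:R / (k%:R + 1) <= 1 :> R by rewrite ler_pdivrMr; lra.
  have hn : `|(N - (k%:R + 1)) / N| <= N^-1.
    rewrite normrM [X in _ * X]gtr0_norm // ler_piMl ?ler_norml; lra.
  rewrite normrM (ger0_norm hj0).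
  apply: le_trans (ler_pM hj0 (normr_ge0 _) hj1 hn) _; lra.
have := ler_normD (rpr P [set w | (#|` never_visited S A w| < j)%N] - c) (c - j%:R / N).
rewrite addrA subrK => /le_trans; apply; apply: le_trans (lerD law hc) _.
have hj : N * (4 / (j%:R + 1)) <= 4 * (N / j%:R).
  rewrite mulrCA ler_pM2l // ler_pM2l // lef_pV2 ?posrE; lra.
have h3 : N * (K1 * (q + ell)) * (4 / (j%:R + 1)) <= 4 * K1 * (q + ell) * (N / j%:R).
  rewrite [leLHS](_ : _ = K1 * (q + ell) * (N * (4 / (j%:R + 1)))); last by ring.
  rewrite [leRHS](_ : _ = K1 * (q + ell) * (4 * (N / j%:R))); last by ring.
  by rewrite ler_wpM2l // mulr_ge0; lra.
apply: le_trans (lerD h3 (lexx _)) _.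
have nj0 : 0 <= N / j%:R by rewrite divr_ge0; lra.
have p1 : 0 <= K1 * (q + ell) by rewrite mulr_ge0; lra.
have qe : 0 <= q + ell by lra.
have p3 : 0 <= (q + ell) * (N / j%:R) by rewrite mulr_ge0.
have p2 : 0 <= K2 * ((q + ell) * (N / j%:R)) by rewrite mulr_ge0 // ltW.
have p4 : 0 <= K2 * ell by rewrite mulr_ge0; lra.
lra.
Qed.

(** For j >= dl |A| with dl = q^(1/3) the preceding bound applies. A smaller j is dominated
by the first integer above dl |A|, for which the bound gives O(dl) up to the same error. The additional
|A|^-1 leaves room for rounding s |A| to an integer. *)
Lemma never_visited_cdf (R : realType) (M0 : R) : 0 < M0 ->
  exists c : R, 0 < c /\
  forall (d : measure_display) (Omega : measurableType d)
    (P : probability Omega R) (x0 : Z2) (S : nat -> Omega -> Z2),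
    adj 0 x0 -> conditioned_walk P x0 S ->
  forall (n : nat) (A : {fset Z2}), (3 <= n)%N -> A != fset0 -> in_annulus M0 n A ->
  forall j : nat, (j <= #|` A|.+1)%N ->
    `|rpr P [set w | (#|` never_visited S A w| < j)%N] - j%:R / #|` A|%:R| +
      #|` A|%:R^-1 <= error_bound M0 c c n A.
Proof.
move=> hM0; have [K [K0 h]] := never_visited_annulus_law hM0.
exists (4 * K + 3); split; first by lra.
move=> d Omega P x0 S hx0 hS n A n3 A0 hA j jA.
have {}h := h d Omega P x0 S hx0 hS n A n3 A0 hA.
rewrite /error_bound -/(log_ratio R n); set q := log_ratio R n in h *.
set ell := max_local_frac M0 n A in h *; set N : R := #|` A|%:R in h *.
set F := fun j => rpr P [set w | (#|` never_visited S A w| < j)%N] in h *.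
rewrite -/(F j).
have L1 := ln_nat_gt1 R n3; have LL := lnln_ge R n3; have c0 := lnln3_gt0 R.
have q0 : 0 < q by rewrite /q /log_ratio divr_gt0; lra.
have q1 : q <= 1.
  rewrite /q /log_ratio ler_pdivrMr; last by lra.
  by rewrite mul1r; have := @ln_le_sub1 R (ln n%:R); lra.
have cA : (0 < #|` A|)%N by rewrite cardfs_gt0.
have Np : 0 < N by rewrite ltr0n.
have ellN : N^-1 <= ell := inv_card_le_max_local_frac M0 n3 A0.
have Np' : 0 < N^-1 by rewrite invr_gt0.
pose dl := q `^ (1 / 3).
have dl0 : 0 < dl by rewrite powR_gt0.
have dl3 : dl ^+ 3 = q.
  rewrite -powR_mulrn ?ltW // -powRrM (_ : 1 / 3 * 3%:R = 1); last by field.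
  by rewrite powRr1 // ltW.
have dl1 : dl <= 1.
  rewrite leNgt; apply/negP => d1.
  have : 1 < dl ^+ 3 by rewrite exprn_egt1.
  by rewrite dl3; lra.
have -> : q `^ (- (2 / 3)) = (dl ^+ 2)^-1.
  by rewrite powRN -powR_mulrn ?ltW // -powRrM; congr (_ `^ _)^-1; field.
rewrite -/dl; set v := (dl ^+ 2)^-1.
have v1 : 1 <= v by rewrite invf_ge1 ?exprn_gt0 // expr_le1 // ltW.
have dlv : dl^-1 <= v.
  by rewrite /v lef_pV2 ?posrE ?exprn_gt0 // expr2 ler_piMl // ltW.
have qdl : q / dl <= dl.
  rewrite -dl3 ler_pdivrMr // -expr2 -[leLHS]mulr1 exprSr.
  by rewrite mulr1 ler_piMr // sqr_ge0.
have qd : q <= dl.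
  by apply: le_trans qdl; rewrite ler_pdivlMr // ler_piMr // ltW.
have el0 : 0 <= ell by lra.
have elv : ell <= ell * v by rewrite ler_peMr.
have eldl : ell / dl <= ell * v by rewrite ler_wpM2l.
have big i : dl * N <= i%:R -> (i <= #|` A|.+1)%N ->
    `|F i - i%:R / N| <= 2 * K * (dl + ell * v).
  move=> hi iA; have ip : 0 < i%:R :> R by apply: lt_le_trans hi; rewrite mulr_gt0.
  have i0 : (0 < i)%N by rewrite -(ltr0n R).
  apply: le_trans (h i i0 iA) _.
  have hN : N / i%:R <= dl^-1.
    by rewrite ler_pdivrMr // mulrC ler_pdivlMr // mulrC.
  have s1 : (q + ell) * (N / i%:R) <= (q + ell) * dl^-1.
    by rewrite ler_wpM2l //; lra.
  have s2 : K * ((q + ell) * (1 + N / i%:R)) <= K * (2 * (dl + ell * v)).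
    rewrite ler_pM2l // mulrDr mulr1; lra.
  by rewrite -mulrA; lra.
have mF i : measurable [set w | (#|` never_visited S A w| < i)%N].
  exact: measurable_never_visited hS A i.
have F0 i : 0 <= F i by apply: rpr_ge0.
have elv0 : 0 <= ell * v by rewrite mulr_ge0; lra.
have Kd : 0 <= K * dl by rewrite mulr_ge0; lra.
have Ke : 0 <= K * (ell * v) by rewrite mulr_ge0 //; lra.
have [hj|hj] := lerP (dl * N) j%:R.
  by have := big j hj jA; lra.
have dN0 : 0 <= dl * N by rewrite mulr_ge0; lra.
(* J is at most |A| + 1 because dl <= 1. *)
pose J := (Num.truncn (dl * N)).+1.
have /andP[J1 J2] := Num.Theory.truncn_itv dN0.
have JA : (J <= #|` A|.+1)%N.
  rewrite ltnS -(ler_nat R); apply: le_trans J1 _.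
  by rewrite -[leRHS]mul1r ler_pM2r.
have bJ := big J (ltW J2) JA.
have FJ : F j <= F J.
  apply: rpr_le => // w /= hw; apply: leq_trans hw _.
  by rewrite -(ler_nat R); apply: ltW; apply: lt_trans J2.
have J3 : J%:R / N <= dl + N^-1.
  by rewrite ler_pdivrMr // mulrDl mulVf ?gt_eqF // /J -natr1; lra.
have j3 : 0 <= j%:R / N <= dl by rewrite divr_ge0 ?ler_pdivrMr // ltW.
have : `|F j - j%:R / N| <= 2 * K * (dl + ell * v) + dl + N^-1.
  have := F0 j; move: bJ; rewrite !ler_norml; lra.
lra.
Qed.

Theorem theorem1p2 (R : realType) (M0 : R) (hM0 : 0 < M0) :
  exists c1 c2 : R, [/\ 0 < c1, 0 < c2 &
    forall (d : measure_display) (Omega : measurableType d)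
      (P : probability Omega R) (x0 : Z2) (S : nat -> Omega -> Z2),
      adj 0 x0 -> conditioned_walk P x0 S ->
    forall (n : nat) (A : {fset Z2}),
      (3 <= n)%N ->
      A != fset0 ->
      {in A, forall x, x \in eball 0 (n%:R : R) /\
                       x \notin eball 0 (inner_radius M0 n)} ->
    forall s : R, 0 <= s <= 1 ->
      `|fine (P [set w | vacant_frac R S A w <= s]) - s|
        <= error_bound M0 c1 c2 n A /\
      `|fine (P [set w | visited_frac R S A w <= s]) - s|
        <= error_bound M0 c1 c2 n A].
Proof.
have [c [c0 h]] := never_visited_cdf hM0.
exists c, c; split=> // d Omega P x0 S hx0 hS n A n3 A0 hA s /andP[s0 s1].
have {}h := h d Omega P x0 S hx0 hS n A n3 A0 hA.
set N : R := #|` A|%:R in h.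
have Np : 0 < N by rewrite ltr0n cardfs_gt0.
have sN0 : 0 <= s * N by rewrite mulr_ge0 // ltW.
pose m := Num.truncn (s * N).
have /andP[m1 m2] := Num.Theory.truncn_itv sN0.
have mA : (m <= #|` A|)%N.
  by rewrite -(ler_nat R); apply: le_trans m1 _; rewrite -[leRHS]mul1r ler_pM2r.
have ms (k : nat) : (k%:R / N <= s) = (k <= m)%N.
  by rewrite ler_pdivrMr // Num.Theory.truncn_ge_nat.
have m1' : m%:R / N <= s by rewrite ms.
have m2' : s <= m%:R / N + N^-1.
  by rewrite -(ler_pM2r Np) mulrDl divfK ?mulVf ?gt_eqF // natr1 ltW.
(* The vacant fraction is at most s when fewer than m + 1 sites are never visited,
   and the visited one when at least |A| - m sites are never visited. *)
split.
  have -> : [set w | vacant_frac R S A w <= s] =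
            [set w | (#|` never_visited S A w| < m.+1)%N].
    by apply/funext => w; apply/propext; rewrite /= /vacant_frac -/N ms.
  have := h m.+1 mA; rewrite -natr1 mulrDl mul1r -/(rpr P _).
  set b := error_bound _ _ _ _ _; rewrite -lerBrDr !ler_norml; lra.
have -> : [set w | visited_frac R S A w <= s] =
          ~` [set w | (#|` never_visited S A w| < #|` A| - m)%N].
  apply/funext => w; apply/propext; rewrite /= /visited_frac -/N ms.
  have e : (#|` [fset y in A | y \in walk_range S w]%fset| + #|` never_visited S A w|
      = #|` A|)%N.
    rewrite -[in RHS](cardfsID (never_visited S A w) A) addnC; congr (_ + _)%N.
      by congr (#|` _|); apply/fsetP => y; rewrite !inE andbA andbb.
    congr (#|` _|); apply/fsetP => y; rewrite !inE.
    by case: (y \in A) => //=; rewrite negbK andbT.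
  move: e; set u := #|` _|; set v := #|` _| => e.
  by rewrite -e; clear; split=> hu; lia.
rewrite -/(rpr P _) rprC; last exact: measurable_never_visited hS A _.
have := h (#|` A| - m)%N (leq_trans (leq_subr _ _) (leqnSn _)).
rewrite natrB // -/N mulrBl divff ?gt_eqF //.
set b := error_bound _ _ _ _ _; rewrite -lerBrDr !ler_norml; lra.
Qed.
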